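(* Suppose $(\tau_0-E)u=0$ has a positive solution and let $u_0$ be a minimal positive solution. Define $v_0$ by $$v_0(x)=u_0(x)\int_a^x\frac{dt}{p_0(t)u_0(t)^2},$$ and suppose $$\lim_{x\to b}p_0v_0\,p_0u_0'\,\Delta p=\lim_{x\to b}p_0\,\Delta p=0 .$$ Then $\tau_1-E$ is oscillatory if $$\limsup_{x\to b}\,p_0v_0^2\big(u_0^2\,\Delta q+(p_0u_0')^2\,\Delta p\big)<-\frac14$$ and nonoscillatory if $$\liminf_{x\to b}\,p_0v_0^2\big(u_0^2\,\Delta q+(p_0u_0')^2\,\Delta p\big)>-\frac14 .$$
   Context: Let $-\infty<a<b\le\infty$ and $\tau_j=\frac1r\left(-\frac{d}{dx}p_j\frac{d}{dx}+q_j\right)$, $j=0,1$, on $(a,b)$, where the coefficients are real-valued with $p_j^{-1},q_j,r\in L^1_{loc}(a,b)$ and $p_j,r>0$. Standing assumptions: for both $\tau_0$ and $\tau_1$ the endpoint $a\in\mathbb R$ is regular (i.e. $q_j,p_j^{-1},r$ are integrable near $a$) and $b$ is limit point (i.e. $(\tau_j-z)u=0$ has, up to multiples, at most one solution which is in $L^2(r\,dx)$ near $b$). $E\in\mathbb R$. Notation: $\Delta p=\frac1{p_0}-\frac1{p_1}$, $\Delta q=q_1-q_0$. A positive solution $u_0$ of $(\tau_0-E)u_0=0$ is called minimal (principal) near $b$ if $\int^b\frac{dt}{p_0(t)u_0(t)^2}=\infty$. $\tau_1-E$ is called nonoscillatory if one (equivalently, every) nontrivial solution of $(\tau_1-E)u=0$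 has finitely many zeros in $(a,b)$, and oscillatory otherwise. *)

(* Defs.v *)
From HB Require Import structures.
From mathcomp Require Import all_boot all_order all_algebra.
From mathcomp Require Import all_classical all_reals all_analysis.
From mathcomp Require Import complex.

Set Implicit Arguments.
Unset Strict Implicit.
Unset Printing Implicit Defensive.

Import Order.TTheory GRing.Theory Num.Theory.
Import numFieldNormedType.Exports.

Local Open Scope classical_set_scope.
Local Open Scope ring_scope.

Definition oint (R : realType) (a : R) (b : \bar R) : set R :=
  [set x | a < x /\ (x%:E < b)%E].

(* The filter of x -> b with x < b. The value at -oo is never relevant, since
   b is the right endpoint of an interval (a, b) with a real. *)
Definition left_end (R : realType) (b : \bar R) : set_system R :=
  match b with
  | EFin b' => at_left b'
  | +oo%E => pinfty_nbhs R
  | -oo%E => ninfty_nbhs R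
  end.

(* AC_loc(a, b), i.e. the indefinite integrals of L^1_loc functions. *)
Definition ac_loc (R : realType) (a : R) (b : \bar R) (f : R -> R) : Prop :=
  exists g : R -> R, locally_integrable (oint a b) g /\
    forall x y, oint a b x -> oint a b y -> x <= y ->
      f y - f x = \int[lebesgue_measure]_(t in `[x, y]) g t.

(* [r] is the weight; measurability of p and 1/p are equivalent. *)
Definition sl_coeffs (R : realType) (a : R) (b : \bar R) (p q r : R -> R) :
    Prop :=
  [/\ locally_integrable (oint a b) (fun x => (p x)^-1),
      locally_integrable (oint a b) q,
      locally_integrable (oint a b) r &
      forall x, oint a b x -> 0 < p x /\ 0 < r x].

Definition regular_left (R : realType) (a : R) (b : \bar R) (p q r : R -> R) :
    Prop :=
  exists c, oint a b c /\
  [/\ lebesgue_measure.-integrable (oint a c%:E) (EFin \o (fun x => (p x)^-1)),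
      lebesgue_measure.-integrable (oint a c%:E) (EFin \o q) &
      lebesgue_measure.-integrable (oint a c%:E) (EFin \o r)].

(* [w] is the quasi-derivative p u', which equals p x * derive1 u x only almost
   everywhere: [w] stands for its locally absolutely continuous (in particular
   continuous) representative, unique on (a, b). Derivatives of locally
   absolutely continuous functions exist almost everywhere. *)
Definition sl_dom (R : realType) (a : R) (b : \bar R) (p u w : R -> R) : Prop :=
  [/\ ac_loc a b u, ac_loc a b w &
      {ae lebesgue_measure, forall x, oint a b x -> w x = p x * derive1 u x}].

(* tau u = ( - (p u')' + q u) / r, with w = p u' *)
Definition sl_tau (R : realType) (q r u w : R -> R) (x : R) : R :=
  (r x)^-1 * (- derive1 w x + q x * u x).

Definition sl_solution (R : realType) (a : R) (b : \bar R) (p q r : R -> R)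
    (E : R) (u w : R -> R) : Prop :=
  sl_dom a b p u w /\
  {ae lebesgue_measure, forall x, oint a b x -> sl_tau q r u w x = E * u x}.

(* Complex-valued solutions of (tau - z) u = 0; the coefficients being real,
   tau acts separately on real and imaginary parts. *)
Definition sl_csolution (R : realType) (a : R) (b : \bar R) (p q r : R -> R)
    (z : R[i]) (u : R -> R[i]) : Prop :=
  exists w1 w2 : R -> R,
    let u1 := fun x => complex.Re (u x) in
    let u2 := fun x => complex.Im (u x) in
    [/\ sl_dom a b p u1 w1, sl_dom a b p u2 w2 &
        {ae lebesgue_measure, forall x, oint a b x ->
           Complex (sl_tau q r u1 w1 x) (sl_tau q r u2 w2 x) = z * u x}].

Definition L2_near_right (R : realType) (a : R) (b : \bar R) (r : R -> R)
    (u : R -> R[i]) : Prop :=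
  exists c, oint a b c /\
    (\int[lebesgue_measure]_(x in oint c b)
       ((complex.Re (u x) ^+ 2 + complex.Im (u x) ^+ 2) * r x)%:E < +oo)%E.

(* By Weyl's alternative the condition does not depend on z. *)
Definition limit_point_right (R : realType) (a : R) (b : \bar R)
    (p q r : R -> R) : Prop :=
  exists z : R[i], forall u v : R -> R[i],
    sl_csolution a b p q r z u -> L2_near_right a b r u ->
    sl_csolution a b p q r z v -> L2_near_right a b r v ->
    exists c d : R[i], (c != 0 \/ d != 0) /\
      forall x, oint a b x -> c * u x + d * v x = 0.

Definition minimal_solution (R : realType) (a : R) (b : \bar R)
    (p q r : R -> R) (E : R) (u w : R -> R) : Prop :=
  [/\ sl_solution a b p q r E u w,
      forall x, oint a b x -> 0 < u x &
      exists c, oint a b c /\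
        (\int[lebesgue_measure]_(t in oint c b) ((p t * u t ^+ 2)^-1)%:E
           = +oo)%E].

Definition nonoscillatory (R : realType) (a : R) (b : \bar R)
    (p q r : R -> R) (E : R) : Prop :=
  exists u w : R -> R,
    [/\ sl_solution a b p q r E u w,
        exists2 x, oint a b x & u x <> 0 &
        finite_set [set x | oint a b x /\ u x = 0]].

Definition oscillatory (R : realType) (a : R) (b : \bar R)
    (p q r : R -> R) (E : R) : Prop :=
  ~ nonoscillatory a b p q r E.

(* Main.v *)
Require Import Defs.
From HB Require Import structures.
From mathcomp Require Import all_boot all_order all_algebra.
From mathcomp Require Import all_classical all_reals all_analysis.
From mathcomp Require Import measurable_realfun.
From mathcomp Require Import ring lra.
Set Implicit Arguments.
Unset Strict Implicit.
Unset Printing Implicit Defensive.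
Import Order.TTheory GRing.Theory Num.Theory.
Import numFieldNormedType.Exports.
Local Open Scope classical_set_scope.
Local Open Scope ring_scope.

(** Let u_0 be the minimal positive solution and phi = int_a^x dt / (p_0 u_0^2),
    so that v_0 = phi u_0 is a second solution and phi tends to infinity at b.
    Put e1 = p_0 v_0 p_0 u_0' (1/p_0 - 1/p_1), e2 = p_0 (1/p_0 - 1/p_1) and let Q be
    the expression of the criterion. For a solution u of (tau_1 - E) u = 0 with
    quasi-derivative w, the pair y = u / u_0, d = phi (u_0 w - w_0 u) satisfies, with
    respect to the variable log phi, the system
      y' = (1 - e2) d - e1 y,    d' = (1 + e1) d + Q y.
    Since e1 and e2 tend to 0, this is a perturbation of y'' - y' - Q y = 0, whose
    characteristic roots are real exactly for Q >= - 1/4. Two scalar consequences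
    of the system give the theorem, both checked by direct differentiation.

    If limsup Q < - 1/4 and u has no zeros near b, then rho = d / y satisfies
      rho' = Q + (1 + 2 e1) rho - (1 - e2) rho^2 <= - k (1 + rho^2)
    with some k > 0 ([riccati_primitive], [riccati_decay]), so atan rho decreases at
    least as fast as - k log phi, which is unbounded while atan is not
    ([oscillatory_of_decay]).

    If liminf Q > - 1/4, then G = y (d - y / 2) / phi = u w - h u^2, where
    h = w_0 / u_0 + 1 / (2 u_0^2 phi), has derivative
      (w - h u)^2 / p_1 + (Q + e1 + 1/4 + e2/4) u^2 / (p_0 u_0^4 phi^2)
    with respect to x, which is positive near b ([picone_primitive]). As G vanishes
    at every zero of u, there is at most one zero near b, and a solution started at
    the regular endpoint a has finitely many zeros on any [a, c]
    ([nonoscillatory_of_subsolution]).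

    The coefficients being merely locally integrable, the functions involved are
    absolutely continuous and the computations need a chain and a product rule for
    indefinite integrals ([primitive_comp], [primitiveM]), the passage between the
    differential equations and integral equations ([sl_solutionP]), and an
    existence theorem for linear systems with integrable coefficients
    ([system_exists]), obtained by Picard iteration in a weighted supremum norm. *)

(** * Absolutely continuous functions on a segment *)

(** An absolutely continuous function on [x, y], recorded together with an
    integrable derivative. The pair is what the calculus rules below act on:
    pointwise derivatives only enter when passing to and from the differential
    equations. *)
Definition primitive_on (R : realType) (x y : R) (f g : R -> R) : Prop :=
  lebesgue_measure.-integrable `[x, y] (EFin \o g) /\
  forall s t, x <= s -> s <= t -> t <= y ->
    f t - f s = \int[lebesgue_measure]_(u in `[s, t]) g u.

Section Primitives.
Context {R : realType}.
Notation mu := (@lebesgue_measure R).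
Implicit Types (x y s t e : R) (f g F : R -> R).

Lemma integrable_segmentS f x y s t : x <= s -> t <= y ->
  mu.-integrable `[x, y] (EFin \o f) -> mu.-integrable `[s, t] (EFin \o f).
Proof.
move=> xs ty; apply: integrableS => //.
by apply: subset_itv; rewrite bnd_simp.
Qed.

Lemma Rintegral_segment_cat f x y s t v : x <= s -> s <= t -> t <= v -> v <= y ->
  mu.-integrable `[x, y] (EFin \o f) ->
  \int[mu]_(u in `[s, v]) f u =
  \int[mu]_(u in `[s, t]) f u + \int[mu]_(u in `[t, v]) f u.
Proof.
move=> xs st tv vy fi.
have fsv : mu.-integrable `[s, v] (EFin \o f) by exact: integrable_segmentS fi.
rewrite -(Rintegral_itv_obnd_cbnd (r := t)); last first.
  apply: integrableS fsv => //.
  by apply: subset_itv; rewrite bnd_simp.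
by rewrite -(Rintegral_itvB fsv) ?bnd_simp// subrKC.
Qed.

Lemma primitive_integral f x y : mu.-integrable `[x, y] (EFin \o f) ->
  primitive_on x y (fun t => \int[mu]_(u in `[x, t]) f u) f.
Proof.
move=> fi; split=> // s t xs st ty.
by rewrite (@Rintegral_segment_cat f x y x s t) ?lexx// addrC addKr.
Qed.

Lemma primitiveS f g x y s t : x <= s -> t <= y ->
  primitive_on x y f g -> primitive_on s t f g.
Proof.
move=> xs ty [gi fg]; split; first exact: integrable_segmentS gi.
by move=> s' t' ss' st' tt'; apply: fg => //; [exact: le_trans ss'|exact: le_trans ty].
Qed.

Lemma eq_primitive f g g' x y : (forall t, x <= t -> t <= y -> g t = g' t) ->
  primitive_on x y f g -> primitive_on x y f g'.
Proof.
move=> gg' [gi fg]; split.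
  apply: eq_integrable gi => //= t; rewrite inE /= in_itv /= => /andP[xt ty].
  by rewrite gg'.
move=> s t xs st ty; rewrite fg//; apply: eq_Rintegral => u.
rewrite inE /= in_itv /= => /andP[su ut].
by rewrite gg'//; [exact: le_trans su|exact: le_trans ty].
Qed.

Lemma eq_primitivel f f' g x y : (forall t, x <= t -> t <= y -> f t = f' t) ->
  primitive_on x y f g -> primitive_on x y f' g.
Proof.
move=> ff' [gi fg]; split => // s t xs st ty.
by rewrite -!ff' ?fg//; [exact: le_trans ty|exact: le_trans st].
Qed.

Lemma primitive_cst (c : R) x y : primitive_on x y (fun=> c) (fun=> 0).
Proof.
split; first exact: (@integrable0 _ _ R mu `[x, y]).
by move=> s t _ _ _; rewrite subrr Rintegral_cst// mul0r.
Qed.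

Lemma primitiveD f1 g1 f2 g2 x y :
  primitive_on x y f1 g1 -> primitive_on x y f2 g2 ->
  primitive_on x y (fun t => f1 t + f2 t) (fun t => g1 t + g2 t).
Proof.
move=> [gi1 fg1] [gi2 fg2]; split.
  by apply: (@integrableD _ _ _ mu `[x, y] _ (EFin \o g1) (EFin \o g2)).
move=> s t xs st ty; rewrite RintegralD//; try exact: integrable_segmentS xs ty _.
rewrite -fg1// -fg2//; ring.
Qed.

Lemma primitiveZ (c : R) f g x y :
  primitive_on x y f g -> primitive_on x y (fun t => c * f t) (fun t => c * g t).
Proof.
move=> [gi fg]; split.
  by apply: (@integrableZl _ _ _ mu `[x, y] _ c (EFin \o g)).
move=> s t xs st ty; rewrite RintegralZl//; last exact: integrable_segmentS xs ty _.
rewrite -fg//; ring.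
Qed.

Lemma primitive_continuous f g x y : x <= y -> primitive_on x y f g ->
  {within `[x, y], continuous f}.
Proof.
move=> xy [gi fg].
have := parameterized_integral_continuous xy gi.
rewrite /parameterized_integral => ci.
have : {within `[x, y], continuous (fun t => f x + \int[mu]_(u in `[x, t]) g u)}.
  by move=> t; apply: cvgD; [exact: cvg_cst|exact: ci].
apply: subspace_eq_continuous => t; rewrite inE /= in_itv /= => /andP[xt ty].
by rewrite /from_subspace /= -fg// subrKC.
Qed.

Lemma within_continuousP f x y t : {within `[x, y], continuous f} ->
  x <= t -> t <= y -> forall e, 0 < e -> exists2 d, 0 < d &
  forall s, x <= s -> s <= y -> `|s - t| < d -> `|f s - f t| < e.
Proof.
move=> /subspace_continuousP cf xt ty e e0.
have txy : `[x, y]%classic t by rewrite /= in_itv /= xt.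
have /cvgrPdist_lt/(_ _ e0) := cf t txy.
rewrite near_withinE => -[d /= d0 H]; exists d => // s xs sy sd.
rewrite distrC; apply: H => /=; first by rewrite /ball_ /= distrC.
by rewrite in_itv /= xs.
Qed.

Lemma integrable_mul_continuous f g x y : {within `[x, y], continuous f} ->
  mu.-integrable `[x, y] (EFin \o g) ->
  mu.-integrable `[x, y] (EFin \o (fun t => f t * g t)).
Proof.
move=> cf gi.
have mf : measurable_fun `[x, y] f by exact: subspace_continuous_measurable_fun.
apply: (@integrableMr _ _ _ mu `[x, y] _ f (EFin \o g)) => //.
have /compact_bounded[M [_ mrt]] := continuous_compact cf (@segment_compact _ x y).
by exists M; split; rewrite ?num_real // => ? ? ? ?; exact: mrt.
Qed.

Lemma integrable_mul_continuousr f g x y : {within `[x, y], continuous f} ->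
  mu.-integrable `[x, y] (EFin \o g) ->
  mu.-integrable `[x, y] (EFin \o (fun t => g t * f t)).
Proof.
move=> cf gi; have -> : (fun t => g t * f t) = (fun t => f t * g t).
  by apply/funext => t; rewrite mulrC.
exact: integrable_mul_continuous.
Qed.

(** The points up to which the inequality holds form a set whose supremum
    belongs to it and, by the local inequality there, can only be y. *)
Lemma local_increment_le (h m : R -> R) e x y : x <= y ->
  (forall t, x <= t -> t <= y -> exists2 d, 0 < d &
    forall s s', x <= s -> s <= t -> t <= s' -> s' <= y ->
      t - d < s -> s' < t + d -> h s' - h s <= e * (m s' - m s)) ->
  h y - h x <= e * (m y - m x).
Proof.
move=> xy H.
pose S := [set t | [/\ x <= t, t <= y & h t - h x <= e * (m t - m x)]].
have Sx : S x by split; rewrite ?lexx// !subrr mulr0.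
have hS : has_sup S by split; [exists x|exists y => t []].
have xs : x <= sup S by apply: ub_le_sup Sx; case: hS.
have sy : sup S <= y by apply: ge_sup => [|t []]; first by exists x.
have [d d0 Hd] := H _ xs sy.
have [t [xt ty Ht] st] := sup_adherent d0 hS.
have ts : t <= sup S by apply: ub_le_sup; [case: hS|split].
(* a point beyond sup S at which the local inequality still applies *)
pose s' := Num.min y (sup S + d / 2).
have s's : sup S <= s' by rewrite le_min sy lerDl divr_ge0// ltW.
have s'y : s' <= y by rewrite ge_min lexx.
have s'd : s' < sup S + d by rewrite gt_min; apply/orP; right; rewrite ltrD2l; lra.
have := Hd t s' xt ts s's s'y st s'd => Hs.
have Ss' : S s' by split => //; [exact: le_trans s's|lra].
have s's2 : s' <= sup S by apply: ub_le_sup; [case: hS|].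
have : s' = y.
  rewrite /s'; case: (leP y (sup S + d / 2)) => // lt.
  by exfalso; move: s's2; rewrite /s' (min_r (ltW lt)) => ?; lra.
by move=> <-; case: Ss'.
Qed.

(** A function whose increments agree locally, up to an arbitrarily small
    multiple of some finite measure, with those of an indefinite integral is
    that indefinite integral. This replaces the epsilon-delta notion of absolute
    continuity in the calculus rules below. *)
Lemma primitive_of_local f g (m : R -> R) x y :
  mu.-integrable `[x, y] (EFin \o g) -> mu.-integrable `[x, y] (EFin \o m) ->
  (forall t e, x <= t -> t <= y -> 0 < e -> exists2 d, 0 < d &
    forall s s', x <= s -> s <= t -> t <= s' -> s' <= y ->
      t - d < s -> s' < t + d ->
      `|f s' - f s - \int[mu]_(u in `[s, s']) g u| <=
        e * \int[mu]_(u in `[s, s']) m u) ->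
  primitive_on x y f g.
Proof.
move=> gi mi H; split=> // s t xs st ty.
have [_ pm] := primitive_integral mi.
have [_ pg] := primitive_integral gi.
set G := fun t => \int[mu]_(u in `[x, t]) g u in pg.
set M := fun t => \int[mu]_(u in `[x, t]) m u in pm.
have key (c : R) e : `|c| = 1 -> 0 < e ->
    c * (f t - G t) - c * (f s - G s) <= e * (M t - M s).
  move=> c1 e0.
  apply: (@local_increment_le (fun t => c * (f t - G t)) M e s t) => // v sv vt.
  have [||d d0 Hd] := H v e _ _ e0; [exact: le_trans sv|exact: le_trans ty|].
  exists d => // w w' sw wv vw' w't dw dw'.
  have := Hd w w' (le_trans xs sw) wv vw' (le_trans w't ty) dw dw'.
  rewrite -pm ?(le_trans xs sw) ?(le_trans wv vw') ?(le_trans w't ty)//.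
  rewrite -pg ?(le_trans xs sw) ?(le_trans wv vw') ?(le_trans w't ty)//.
  apply: le_trans; rewrite -mulrBr; apply: (le_trans (ler_norm _)).
  rewrite normrM c1 mul1r le_eqVlt; apply/orP; left; apply/eqP; congr `| _ |.
  rewrite /G; ring.
rewrite -pg//.
have lim0 (A B : R) : (forall e, 0 < e -> A <= e * B) -> A <= 0.
  move=> AB; rewrite leNgt; apply/negP => A0.
  have B0 : 0 < B by have := AB 1 ltr01; lra.
  have := AB (A / 2 / B); rewrite divfK ?lt0r_neq0//.
  have : 0 < A / 2 / B by rewrite !divr_gt0.
  by move=> -> /(_ isT); lra.
have h1 := lim0 _ _ (fun e => @key 1 e (normr1 _)).
have h2 := lim0 _ _ (fun e => @key (-1) e (normrN1 _)).
move: h1 h2; rewrite /G => h1 h2.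
apply/eqP; rewrite eq_le; apply/andP; split; lra.
Qed.

(** Chain rule. Between s and s' the increment of F o f is F'(f c) times that of
    f, that is, the integral of F'(f c) g, and F'(f c) is close to F'(f u) for
    every u in [s, s']. *)
Lemma primitive_comp F (F' : R -> R) f g x y : x <= y ->
  primitive_on x y f g ->
  (forall t, x <= t -> t <= y -> is_derive (f t) 1 F (F' (f t))) ->
  (forall t, x <= t -> t <= y -> {for f t, continuous F'}) ->
  primitive_on x y (F \o f) (fun t => F' (f t) * g t).
Proof.
move=> xy pfg dF cF.
have cf := primitive_continuous xy pfg.
have cFf : {within `[x, y], continuous (F' \o f)}.
  apply/subspace_continuousP => t txy.
  move/subspace_continuousP : cf => /(_ t txy) cft.
  move: txy; rewrite /= in_itv /= => /andP[xt ty].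
  by apply: cvg_comp cft _; exact: cF.
have [gi fg] := pfg.
have gn : mu.-integrable `[x, y] (EFin \o (fun t => `|g t|)).
  exact: (@integrable_norm _ _ _ mu `[x, y] g).
apply: (@primitive_of_local _ _ (fun t => `|g t|)) => //.
  exact: (integrable_mul_continuous cFf).
move=> t e xt ty e0.
have [|d d0 Hd] := within_continuousP cFf xt ty (e := e / 2); first lra.
exists d => // s s' xs st ts' s'y ds ds'.
have ss' := le_trans st ts'.
(* mean value theorem; f takes on [s, s'] every value between f s and f s' *)
have [c [sc cs' Fc]] : exists c, [/\ s <= c, c <= s' &
    F (f s') - F (f s) = F' (f c) * (f s' - f s)].
  have cfs : {within `[s, s'], continuous f}.
    by apply: continuous_subspaceW cf; apply: subset_itv; rewrite bnd_simp.
  have ivt z : Num.min (f s) (f s') <= z <= Num.max (f s) (f s') ->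
      exists c, [/\ s <= c, c <= s' & f c = z].
    move=> /(IVT ss' cfs)[c]; rewrite in_itv /= => /andP[? ?] fc.
    by exists c.
  have mvt A B : A <= B -> Num.min (f s) (f s') <= A ->
      B <= Num.max (f s) (f s') ->
      exists c, [/\ s <= c, c <= s' & F B - F A = F' (f c) * (B - A)].
    move=> AB mA Bm.
    have dFz z : z \in `[A, B] -> is_derive z 1 F (F' z).
      rewrite in_itv /= => /andP[Az zB].
      have [|c [sc cs' <-]] := ivt z.
        by rewrite (le_trans mA Az) (le_trans zB Bm).
      by apply: dF; [exact: le_trans sc|exact: le_trans s'y].
    have cF' : {within `[A, B], continuous F}.
      by apply: derivable_within_continuous => z /dFz ?; exact: ex_derive.
    have dF' z : z \in `]A, B[ -> is_derive z 1 F (F' z).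
      by rewrite in_itv /= => /andP[/ltW ? /ltW ?]; apply: dFz; rewrite in_itv /=; apply/andP.
    have [z + FAB] := MVT_segment AB dF' cF'.
    rewrite in_itv /= => /andP[Az zB].
    have [|c [sc cs' fc]] := ivt z.
      by rewrite (le_trans mA Az) (le_trans zB Bm).
    by exists c; rewrite fc.
  have [AB|/ltW BA] := leP (f s) (f s').
    by apply: mvt => //; rewrite ?ge_min ?le_max lexx ?orbT.
  have [||c [sc cs' E]] := mvt _ _ BA.
  - by rewrite ge_min lexx orbT.
  - by rewrite le_max lexx.
  by exists c; split => //; move: E; lra.
have sub (h : R -> R) : mu.-integrable `[x, y] (EFin \o h) ->
  mu.-integrable `[s, s'] (EFin \o h) by exact: integrable_segmentS.
rewrite /= Fc fg//.
rewrite -RintegralZl//; last exact: sub.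
rewrite -RintegralB//; last 2 first.
- exact/sub/(@integrableZl _ _ _ mu `[x, y] _ (F' (f c)) (EFin \o g)).
- exact/sub/(integrable_mul_continuous cFf).
rewrite -RintegralZl//; last exact: sub.
have i1 : mu.-integrable `[x, y] (EFin \o (fun u => F' (f c) * g u - F' (f u) * g u)).
  apply: (@integrableB _ _ _ mu `[x, y] _ (EFin \o (fun u => F' (f c) * g u))
    (EFin \o (fun u => F' (f u) * g u))) => //.
    exact: (@integrableZl _ _ _ mu `[x, y] _ (F' (f c)) (EFin \o g)).
  exact: (integrable_mul_continuous cFf).
apply: (le_trans (le_normr_Rintegral _ _)) => //; first exact: sub.
apply: le_Rintegral => //; first exact/sub/(@integrable_norm _ _ _ mu `[x, y]).
  apply/sub/(@integrableZl _ _ _ mu `[x, y] _ e (EFin \o (fun u => `|g u|))) => //.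
move=> u /=; rewrite in_itv /= => /andP[su us'].
rewrite -mulrBl normrM ler_wpM2r//.
have near_t v : s <= v -> v <= s' -> `|(F' \o f) v - (F' \o f) t| < e / 2.
  move=> sv vs'; apply: Hd; [lra|lra|rewrite ltr_norml; lra].
have := near_t c sc cs'; have := near_t u su us'.
rewrite /= !ltr_norml ler_norml => /andP[? ?] /andP[? ?]; lra.
Qed.

(** Polarization reduces the product rule to the chain rule for squares. *)
Lemma primitiveM f1 g1 f2 g2 x y : x <= y ->
  primitive_on x y f1 g1 -> primitive_on x y f2 g2 ->
  primitive_on x y (fun t => f1 t * f2 t) (fun t => g1 t * f2 t + f1 t * g2 t).
Proof.
move=> xy p1 p2.
have sq f g : primitive_on x y f g ->
    primitive_on x y (fun t => f t ^+ 2) (fun t => (2 * f t) * g t).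
  move=> p; apply: (primitive_comp (F := fun z => z ^+ 2) (F' := fun z => 2 * z)) => // t _ _.
    by apply: is_derive_eq; rewrite /GRing.scale /=; ring.
  by apply: cvgM; [exact: cvg_cst|exact: cvg_id].
have pp := sq _ _ (primitiveD p1 p2).
have pm := sq _ _ (primitiveD p1 (primitiveZ (-1) p2)).
have p := primitiveZ (1/4) (primitiveD pp (primitiveZ (-1) pm)).
apply: eq_primitivel (eq_primitive _ p) => t _ _ /=; first by field.
by field.
Qed.

Lemma primitive_le0 f g x y : x <= y -> primitive_on x y f g ->
  (forall t, x <= t -> t <= y -> g t <= 0) -> f y <= f x.
Proof.
move=> xy [gi fg] g0; rewrite -subr_le0 fg// -[leRHS](_ : \int[mu]_(u in `[x, y]) 0 = 0).
  apply: le_Rintegral => //; first exact: (@integrable0 _ _ R mu `[x, y]).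
  by move=> t /=; rewrite in_itv /= => /andP[]; exact: g0.
by rewrite Rintegral_cst// mul0r.
Qed.

Lemma primitive_gt0 f g x y : x < y -> primitive_on x y f g ->
  (forall t, x <= t -> t <= y -> 0 < g t) -> f x < f y.
Proof.
move=> xy [gi fg] g0; rewrite -subr_gt0 fg ?(ltW xy)// lt0r.
rewrite Rintegral_ge0 ?andbT; last first.
  by move=> t /=; rewrite in_itv /= => /andP[xt ty]; exact/ltW/g0.
apply/eqP => I0.
have I0' : (\int[mu]_(t in `[x, y]) `|(EFin \o g) t| = 0)%E.
  rewrite -[LHS]fineK ?I0; last first.
    by apply: (@integrable_fin_num _ _ _ mu `[x, y]) => //; exact: integrable_abse.
  rewrite -[X in _ = X%:E]I0; congr EFin; congr fine; apply: eq_integral => t.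
  rewrite inE /= in_itv /= => /andP[xt ty].
  by rewrite gtr0_norm// g0.
have [N [mN N0 DN]] :=
  (ae_eq_integral_abs mu (measurable_itv _) (measurable_int mu gi)).1 I0'.
have xyN : `[x, y] `<=` N.
  move=> t txy; apply: DN => /= /(_ txy) [] g0t.
  move: txy; rewrite /= in_itv /= => /andP[xt ty].
  by have := g0 t xt ty; rewrite g0t ltxx.
have : (mu `[x, y] <= 0)%E.
  by rewrite -N0; exact: (le_measure mu (mem_set (measurable_itv _)) (mem_set mN) xyN).
rewrite lebesgue_measure_itv /= lte_fin xy -EFinB lee_fin.
by rewrite leNgt subr_gt0 xy.
Qed.
End Primitives.

(** * Absolutely continuous functions on an interval *)

Section LocalPrimitives.
Context {R : realType}.
Notation mu := (@lebesgue_measure R).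
Implicit Types (a x y s t e : R) (b : \bar R) (f g F : R -> R).

Lemma ae_imply (P Q : R -> Prop) : (forall t, P t -> Q t) ->
  {ae mu, forall t, P t} -> {ae mu, forall t, Q t}.
Proof. by move=> PQ; apply: filterS => //; exact: (ae_filter_ringOfSetsType mu). Qed.

Lemma ae_imply2 (P1 P2 Q : R -> Prop) : (forall t, P1 t -> P2 t -> Q t) ->
  {ae mu, forall t, P1 t} -> {ae mu, forall t, P2 t} -> {ae mu, forall t, Q t}.
Proof. by move=> PQ; apply: filterS2 => //; exact: (ae_filter_ringOfSetsType mu). Qed.

Lemma eq_primitive_ae f g g' x y : measurable_fun `[x, y] g' ->
  {ae mu, forall t, x <= t -> t <= y -> g t = g' t} ->
  primitive_on x y f g -> primitive_on x y f g'.
Proof.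
move=> mg' gg' [gi fg].
have mg : measurable_fun `[x, y] g by apply/measurable_EFinP; exact: (measurable_int mu gi).
have aegg' s t : x <= s -> t <= y ->
    ae_eq mu `[s, t]%classic (EFin \o g) (EFin \o g').
  move=> xs ty; apply: ae_imply gg' => u ug; rewrite /= in_itv /= => /andP[su ut].
  by rewrite ug//; [exact: le_trans su|exact: le_trans ty].
split.
  apply/integrableP; split; first exact/measurable_EFinP.
  have /integrableP[_] := gi.
  rewrite (@ge0_ae_eq_integral _ _ _ mu `[x, y] (abse \o (EFin \o g))
    (abse \o (EFin \o g')))//.
  - by apply: measurableT_comp => //; apply/measurable_EFinP.
  - by apply: measurableT_comp => //; apply/measurable_EFinP.
  - by move=> ? _; rewrite /= lee_fin.
  - by move=> ? _; rewrite /= lee_fin.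
  - by apply: ae_imply gg' => u ug; rewrite /= in_itv /= => /andP[xu uy]; rewrite ug.
move=> s t xs st ty; rewrite fg// /Rintegral; congr fine.
have stxy : `[s, t] `<=` `[x, y] by apply: subset_itv; rewrite bnd_simp.
apply: ae_eq_integral => //.
- by apply/measurable_EFinP; apply: measurable_funS mg.
- by apply/measurable_EFinP; apply: measurable_funS mg'.
- exact: aegg'.
Qed.

(** Lebesgue's differentiation theorem. *)
Lemma primitive_derive1 f g x y : primitive_on x y f g ->
  {ae mu, forall t, x < t -> t < y -> derivable f t 1 /\ derive1 f t = g t}.
Proof.
move=> [gi fg].
pose g' := g \_ `[x, y].
have gi' : mu.-integrable setT (EFin \o g').
  by rewrite -restrict_EFin; apply/integrable_restrict => //=; rewrite setTI.
have giy z : mu.-integrable `[x, z] (EFin \o g') by apply: integrableS gi'.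
have := FTC1 (a := BLeft x) giy (integrable_locally_restrict _ gi).
move=> /(_ (measurable_itv _)); apply: ae_imply => t H xt ty.
have [dF Ft] : derivable (fun z => \int[mu]_(u in `[x, z]) g' u) t 1 /\
    derive1 (fun z => \int[mu]_(u in `[x, z]) g' u) t = g' t.
  by apply: H; rewrite /= lte_fin.
(* near t, f differs from the integral of the truncated g by a constant *)
have near_f : \forall z \near t, \int[mu]_(u in `[x, z]) g' u + f x = f z.
  near=> z.
  have xz : x <= z by apply: ltW; near: z; exact: lt_nbhsr.
  have zy : z <= y by near: z; exact: lt_le_nbhsl.
  rewrite -(subrK (f x) (f z)) fg//; congr +%R; apply: eq_Rintegral => u.
  rewrite inE /= in_itv /= => /andP[xu uz].
  by rewrite /g' patchE mem_set//= in_itv /= xu (le_trans uz).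
have : is_derive t 1 (fun z => \int[mu]_(u in `[x, z]) g' u + f x) (g t).
  have dF' : is_derive t 1 (fun z => \int[mu]_(u in `[x, z]) g' u) (g t).
    split => //; rewrite -derive1E Ft /g' patchE mem_set//= in_itv /=.
    by rewrite !ltW.
  by apply: is_derive_eq; rewrite addr0.
move=> /(near_eq_is_derive near_f) ft; split; first exact: ex_derive.
by rewrite derive1E derive_val.
Unshelve. all: by end_near. Qed.

Definition primitive_in a b f g :=
  forall x y, oint a b x -> oint a b y -> x <= y -> primitive_on x y f g.

Lemma oint_between a b x y t : oint a b x -> oint a b y -> x <= t -> t <= y ->
  oint a b t.
Proof.
move=> [ax _] [_ yb] xt ty; split; first exact: lt_le_trans xt.
by apply: le_lt_trans yb; rewrite lee_fin.
Qed.

Lemma oint_itv a x : oint a x%:E = `]a, x[%classic.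
Proof.
apply/seteqP; split=> t; rewrite /oint /= in_itv /= lte_fin; first by move=> [-> ->].
by move=> /andP[].
Qed.

Lemma oint_left a b t : oint a b t -> exists2 x, oint a b x & x < t.
Proof.
move=> [ax tb]; exists ((a + t) / 2); last lra.
split; first lra.
by apply: lt_trans tb; rewrite lte_fin; lra.
Qed.

Lemma oint_right a b t : oint a b t -> exists2 x, oint a b x & t < x.
Proof.
case: b => [b| |]; rewrite /oint /= ?lte_fin.
- by move=> [ax tb]; exists ((t + b) / 2); [rewrite lte_fin; split|]; lra.
- by move=> [ax _]; exists (t + 1); [rewrite ltry; split|]; lra.
- by move=> [].
Qed.

Lemma primitive_in_continuous a b f g t : primitive_in a b f g -> oint a b t ->
  {for t, continuous f}.
Proof.
move=> pf ot; have [x ox xt] := oint_left ot; have [y oy ty] := oint_right ot.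
have xy := ltW (lt_trans xt ty).
apply/cvgrPdist_lt => e e0.
have [d d0 H] := within_continuousP (primitive_continuous xy (pf _ _ ox oy xy))
   (ltW xt) (ltW ty) e0.
near=> s; rewrite distrC; apply: H.
- by apply: ltW; near: s; exact: lt_nbhsr.
- by near: s; exact: lt_le_nbhsl.
- by near: s; apply: filterS (nbhsx_ballx t d d0) => s; rewrite /ball /= distrC.
Unshelve. all: by end_near. Qed.

Lemma primitive_in_derive1 a b f g : primitive_in a b f g ->
  {ae mu, forall t, oint a b t -> derivable f t 1 /\ derive1 f t = g t}.
Proof.
move=> pf.
(* countably many rational segments cover the interval *)
pose good (q : rat * rat) t := oint a b (ratr q.1) -> oint a b (ratr q.2) ->
  ratr q.1 < t -> t < ratr q.2 -> derivable f t 1 /\ derive1 f t = g t.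
have : {ae mu, forall t, forall n,
    if @unpickle (rat * rat)%type n is Some q then good q t else True}.
  apply: ae_foralln => n; case: unpickle => [q|]; last exact: aeW.
  case: (pselect (oint a b (ratr q.1))) => [h1|nh1]; last exact: aeW.
  case: (pselect (oint a b (ratr q.2))) => [h2|nh2]; last exact: aeW.
  have [q12|q21] := leP (ratr q.1 : R) (ratr q.2).
    by apply: ae_imply (primitive_derive1 (pf _ _ h1 h2 q12)) => t H _ _; exact: H.
  by apply: aeW => t _ _ q1t tq2; move: (lt_trans q1t tq2); rewrite ltNge ltW.
apply: ae_imply => t H ot.
have [x ox xt] := oint_left ot; have [y oy ty] := oint_right ot.
have [q1] := rat_in_itvoo xt; rewrite in_itv /= => /andP[xq1 q1t].
have [q2] := rat_in_itvoo ty; rewrite in_itv /= => /andP[tq2 q2y].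
have := H (pickle (q1, q2)); rewrite pickleK; apply => //=.
- exact: (oint_between ox ot (ltW xq1) (ltW q1t)).
- exact: (oint_between ot oy (ltW tq2) (ltW q2y)).
Qed.

Lemma locally_integrable_segment a b g x y : oint a b x -> oint a b y ->
  locally_integrable (oint a b) g -> mu.-integrable `[x, y] (EFin \o g).
Proof.
move=> ox oy [mg oab ig].
have xyab : `[x, y] `<=` oint a b.
  by move=> t; rewrite /= in_itv /= => /andP[xt ty]; exact: oint_between xt ty.
apply/integrableP; split.
  apply/measurable_EFinP; apply: measurable_funS mg => //; exact: open_measurable.
by apply: ig => //; exact: segment_compact.
Qed.

Lemma locally_integrableM a b f g : locally_integrable (oint a b) g ->
  {in oint a b, continuous f} -> locally_integrable (oint a b) (fun t => g t * f t).
Proof.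
move=> [mg oab ig] cf.
have mf : measurable_fun (oint a b) f by exact: open_continuous_measurable_fun.
have moab := open_measurable oab.
split => //; first exact: measurable_funM.
move=> K Kab cK.
have mK := compact_measurable cK.
have cfK : {within K, continuous f}.
  by apply: continuous_in_subspaceT => t /set_mem /Kab tab; apply: cf; rewrite inE.
suff /integrableP[] : mu.-integrable K (EFin \o (fun t => g t * f t)) by [].
apply: (@integrableMl _ _ _ mu K _ (EFin \o g) f) => //.
- apply/integrableP; split; last exact: ig.
  by apply/measurable_EFinP; apply: measurable_funS mg.
- exact: measurable_funS mf.
- have /compact_bounded[M [_ mrt]] := continuous_compact cfK cK.
  by exists M; split; rewrite ?num_real // => ? ? ? ?; exact: mrt.
Qed.

End LocalPrimitives.

(** * The Sturm-Liouville equation as a first order system *)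

(** The integral form u' = P w, w' = S u of a Sturm-Liouville equation, with
    P = 1 / p and S = q - E r. *)
Definition system_in (R : realType) (a : R) (b : \bar R) (P S u w : R -> R) :=
  primitive_in a b u (fun t => P t * w t) /\
  primitive_in a b w (fun t => S t * u t).

Section SturmLiouville.
Context {R : realType}.
Notation mu := (@lebesgue_measure R).
Implicit Types (a x y s t e : R) (b : \bar R) (p q r u w : R -> R).

Lemma ac_locP a b u :
  ac_loc a b u <-> exists2 g, locally_integrable (oint a b) g & primitive_in a b u g.
Proof.
split=> [[g [lg ug]]|[g lg ug]]; last first.
  by exists g; split=> // x y ox oy xy; apply: (ug x y ox oy xy).2; rewrite ?lexx.
exists g => // x y ox oy xy; split; first exact: (locally_integrable_segment ox oy lg).
move=> s t xs st ty.
have os : oint a b s by apply: (oint_between ox oy) => //; exact: le_trans ty.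
by apply: ug => //; apply: (oint_between os oy).
Qed.

Lemma sl_potential_locally_integrable a b p q r E : sl_coeffs a b p q r ->
  locally_integrable (oint a b) (fun t => q t - E * r t).
Proof.
move=> [_ lq lr _].
apply: (@locally_integrableB _ (oint a b) q (fun t => E * r t)) => //.
have -> : (fun t => E * r t) = (fun t => r t * cst E t).
  by apply/funext => t; rewrite mulrC.
apply: locally_integrableM => // t _; exact: cst_continuous.
Qed.

(** By Lebesgue's differentiation theorem the almost everywhere derivative of a
    locally absolutely continuous function is the integrand, so the differential
    equation determines the two integrands up to null sets. *)
Lemma sl_solutionP a b p q r E u w : sl_coeffs a b p q r ->
  sl_solution a b p q r E u w <->
  system_in a b (fun t => (p t)^-1) (fun t => q t - E * r t) u w.
Proof.
move=> hc; have lS := sl_potential_locally_integrable E hc.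
have [lp lq lr pr0] := hc.
have contin f g x y : primitive_in a b f g -> oint a b x -> oint a b y ->
    {within `[x, y], continuous f}.
  move=> fg ox oy; apply: continuous_in_subspaceT => t.
  rewrite inE /= in_itv /= => /andP[xt ty].
  by apply: (primitive_in_continuous fg); exact: (oint_between ox oy).
split.
  move=> [[/ac_locP[g lg ug] /ac_locP[h lh wh] wpu] tau].
  have dug := primitive_in_derive1 ug; have dwh := primitive_in_derive1 wh.
  split=> x y ox oy xy.
  - apply: eq_primitive_ae (ug x y ox oy xy).
      have := integrable_mul_continuousr (contin _ _ _ _ wh ox oy)
        (locally_integrable_segment ox oy lp).
      by move/(measurable_int mu)/measurable_EFinP.
    apply: ae_imply2 wpu dug => t wt ut xt ty.
    have ot : oint a b t := oint_between ox oy xt ty.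
    have [p0 _] := pr0 t ot.
    by rewrite (wt ot) (ut ot).2 mulKf// gt_eqF.
  - apply: eq_primitive_ae (wh x y ox oy xy).
      have := integrable_mul_continuousr (contin _ _ _ _ ug ox oy)
        (locally_integrable_segment ox oy lS).
      by move/(measurable_int mu)/measurable_EFinP.
    apply: ae_imply2 tau dwh => t taut wt xt ty.
    have ot : oint a b t := oint_between ox oy xt ty.
    have [_ r0] := pr0 t ot.
    have := taut ot; rewrite /sl_tau (wt ot).2 => /(congr1 ( *%R (r t))).
    rewrite mulVKf ?gt_eqF// => Er.
    by have -> : h t = q t * u t - r t * (E * u t); [rewrite -Er|]; ring.
move=> [us ws].
have cu : {in oint a b, continuous u}.
  by move=> t /set_mem ot; exact: primitive_in_continuous us ot.
have cw : {in oint a b, continuous w}.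
  by move=> t /set_mem ot; exact: primitive_in_continuous ws ot.
split; first split.
- apply/ac_locP; exists (fun t => (p t)^-1 * w t) => //.
  exact: locally_integrableM.
- apply/ac_locP; exists (fun t => (q t - E * r t) * u t) => //.
  exact: (locally_integrableM lS).
- apply: ae_imply (primitive_in_derive1 us) => t ut ot.
  by rewrite (ut ot).2 mulVKf// gt_eqF// (pr0 t ot).1.
- apply: ae_imply (primitive_in_derive1 ws) => t wt ot.
  rewrite /sl_tau (wt ot).2.
  have := (pr0 t ot).2 => /lt0r_neq0 r0.
  by field.
Qed.

End SturmLiouville.

(** * Solving the system from a regular endpoint *)

Section LinearSystem.
Context {R : realType}.
Notation mu := (@lebesgue_measure R).
Implicit Types (a x y s t e : R) (b : \bar R) (f g h u w P S : R -> R).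

Lemma cvgn_of_geometric_steps (u_ : nat -> R) (c : R) :
  (forall n, `|u_ n.+1 - u_ n| <= c / 2 ^+ n) -> cvgn u_.
Proof.
move=> H.
have c0 : 0 <= c by have := le_trans (normr_ge0 _) (H 0%N); rewrite expr0 divr1.
have cs : cvgn (series (telescope u_)).
  apply: normed_cvg; apply: (series_le_cvg (v_ := geometric c 2^-1)) => [n|n|n|].
  - exact: normr_ge0.
  - by rewrite /= mulr_ge0// exprn_ge0.
  - by rewrite /= exprVn; exact: H.
  - apply: is_cvg_geometric_series; rewrite ger0_norm//; lra.
have -> : u_ = (fun n => u_ 0%N + series (telescope u_) n).
  by apply/funext => n; exact: eq_sum_telescope.
by apply: is_cvgD => //; exact: is_cvg_cst.
Qed.

Lemma norm_le_of_geometric_steps (u_ : nat -> R) (c : R) : u_ 0%N = 0 ->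
  (forall n, `|u_ n.+1 - u_ n| <= c / 2 ^+ n) -> forall n, `|u_ n| <= 2 * c.
Proof.
move=> u0 H n.
have c0 : 0 <= c by have := le_trans (normr_ge0 _) (H 0%N); rewrite expr0 divr1.
suff : `|u_ n| <= 2 * c - 2 * c / 2 ^+ n.
  have : 0 <= 2 * c / 2 ^+ n by rewrite divr_ge0// ?mulr_ge0// exprn_ge0.
  lra.
elim: n => [|n IH]; first by rewrite u0 normr0 expr0 divr1 subrr.
have E : 2 * c / 2 ^+ n.+1 = c / 2 ^+ n.
  by rewrite exprS; field; rewrite expf_neq0.
have E' : 2 * c / 2 ^+ n = 2 * (c / 2 ^+ n) by rewrite mulrA.
have := H n; have := ler_normD (u_ n.+1 - u_ n) (u_ n); rewrite subrK.
rewrite E; move: IH; rewrite E'; lra.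
Qed.

(** The weight exp (2 * int_a^x m) turns integration from a against a kernel
    bounded by m into a contraction with ratio 1/2, whatever the length of the
    segment. *)
Definition bielecki_weight a (m : R -> R) x :=
  expR (2 * \int[mu]_(t in `[a, x]) m t).

Lemma bielecki_weight_primitive a m y : a <= y ->
  mu.-integrable `[a, y] (EFin \o m) ->
  primitive_on a y (bielecki_weight a m) (fun t => bielecki_weight a m t * (2 * m t)).
Proof.
move=> ay mi.
apply: (primitive_comp (F := expR) (F' := expR) ay
  (primitiveZ 2 (primitive_integral mi))) => t _ _.
exact: continuous_expR.
Qed.

Lemma bielecki_weight_ge1 a m x : (forall t, 0 <= m t) -> 1 <= bielecki_weight a m x.
Proof.
move=> m0; rewrite -expR0 ler_expR mulr_ge0//.
by apply: Rintegral_ge0.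
Qed.

Lemma bielecki_contraction a m h f g c y : a <= y ->
  mu.-integrable `[a, y] (EFin \o m) -> mu.-integrable `[a, y] (EFin \o h) ->
  (forall t, `|h t| <= m t) ->
  {within `[a, y], continuous f} -> {within `[a, y], continuous g} ->
  (forall t, a <= t -> t <= y -> `|f t - g t| <= c * bielecki_weight a m t) ->
  `|\int[mu]_(t in `[a, y]) (h t * f t) - \int[mu]_(t in `[a, y]) (h t * g t)|
    <= c / 2 * bielecki_weight a m y.
Proof.
move=> ay mi hi hm cf cg fg.
have [_ Ki] := bielecki_weight_primitive ay mi.
have cK := primitive_continuous ay (bielecki_weight_primitive ay mi).
set K := bielecki_weight a m in Ki cK fg *.
have m0 t : 0 <= m t := le_trans (normr_ge0 _) (hm t).
have c0 : 0 <= c.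
  have := le_trans (normr_ge0 _) (fg a (lexx a) ay).
  by rewrite pmulr_lge0// (lt_le_trans ltr01 (bielecki_weight_ge1 _ _ m0)).
have hfi := integrable_mul_continuousr cf hi.
have hgi := integrable_mul_continuousr cg hi.
have Kmi : mu.-integrable `[a, y] (EFin \o (fun t => c * (K t * m t))).
  apply: (@integrableZl _ _ _ mu `[a, y] _ c (EFin \o (fun t => K t * m t))) => //.
  exact: integrable_mul_continuous.
have di : mu.-integrable `[a, y] (EFin \o (fun t => h t * f t - h t * g t)).
  exact: (@integrableB _ _ _ mu `[a, y] _ (EFin \o (fun t => h t * f t))
    (EFin \o (fun t => h t * g t))).
rewrite -RintegralB//.
apply: (@le_trans _ _ (\int[mu]_(t in `[a, y]) (c * (K t * m t)))).
  apply: (le_trans (le_normr_Rintegral _ _)) => //.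
  apply: le_Rintegral => //; first exact: (@integrable_norm _ _ _ mu `[a, y]).
  move=> t /=; rewrite in_itv /= => /andP[xt ty].
  rewrite -mulrBr normrM [c * _]mulrCA mulrC mulrA; apply: ler_pM => //.
  by rewrite mulrC; exact: fg.
have Kmi' : mu.-integrable `[a, y] (EFin \o (fun t => K t * m t)).
  exact: integrable_mul_continuous.
rewrite RintegralZl//.
have := Ki a y (lexx _) ay (lexx _).
have -> : \int[mu]_(u in `[a, y]) (K u * (2 * m u)) =
          2 * \int[mu]_(u in `[a, y]) (K u * m u).
  rewrite -RintegralZl//; apply: eq_Rintegral => t _; ring.
have Ka : 0 <= K a by rewrite (le_trans ler01)// bielecki_weight_ge1.
set I := Rintegral _ _ _ => E.
have I2 : 2 * I <= K y by rewrite -E gerBl; exact: Ka.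
have : c * (2 * I) <= c * K y by exact: (ler_wpM2l c0 I2).
by rewrite [c / 2 * _]mulrAC ler_pdivlMr// -mulrA [_ * 2]mulrC.
Qed.

Section Picard.
Variables (a : R) (b : \bar R) (P S : R -> R) (ua wa : R).
Hypothesis Pi : forall x, oint a b x -> mu.-integrable `[a, x] (EFin \o P).
Hypothesis Si : forall x, oint a b x -> mu.-integrable `[a, x] (EFin \o S).

(** The iteration starts from 0, so that its first step already has the size of
    the initial values. *)
Fixpoint picard n : (R -> R) * (R -> R) :=
  if n is n.+1 then
    (fun x => ua + \int[mu]_(t in `[a, x]) (P t * (picard n).2 t),
     fun x => wa + \int[mu]_(t in `[a, x]) (S t * (picard n).1 t))
  else (cst 0, cst 0).

Let picardS1 n x :
  (picard n.+1).1 x = ua + \int[mu]_(t in `[a, x]) (P t * (picard n).2 t).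
Proof. by []. Qed.

Let picardS2 n x :
  (picard n.+1).2 x = wa + \int[mu]_(t in `[a, x]) (S t * (picard n).1 t).
Proof. by []. Qed.

Let primitive_cD (c : R) f g x : primitive_on a x f g ->
  primitive_on a x (fun t => c + f t) g.
Proof.
move=> p; have := primitiveD (primitive_cst c a x) p.
by apply: eq_primitive => t _ _; rewrite add0r.
Qed.

Lemma picard_continuous n x : oint a b x ->
  {within `[a, x], continuous (picard n).1} /\
  {within `[a, x], continuous (picard n).2}.
Proof.
move=> ox; have ax : a <= x by case: ox => /ltW.
elim: n => [|n [IH1 IH2]] /=; first by split=> t; exact: cst_continuous.
split.
- apply: primitive_continuous (primitive_cD _ (primitive_integral _)) => //.
  exact: integrable_mul_continuousr (Pi ox).
- apply: primitive_continuous (primitive_cD _ (primitive_integral _)) => //.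
  exact: integrable_mul_continuousr (Si ox).
Qed.

Lemma picard_primitive n y : oint a b y ->
  primitive_on a y (picard n.+1).1 (fun t => P t * (picard n).2 t) /\
  primitive_on a y (picard n.+1).2 (fun t => S t * (picard n).1 t).
Proof.
move=> oy; have [c1 c2] := picard_continuous n oy.
split; apply: primitive_cD; apply: primitive_integral.
- exact: integrable_mul_continuousr (Pi oy).
- exact: integrable_mul_continuousr (Si oy).
Qed.

Let m t := `|P t| + `|S t|.
Let K := bielecki_weight a m.
Let C := `|ua| + `|wa|.

Let mi x : oint a b x -> mu.-integrable `[a, x] (EFin \o m).
Proof.
move=> ox; apply: (@integrableD _ _ _ mu `[a, x] _ (EFin \o (fun t => `|P t|))
   (EFin \o (fun t => `|S t|))) => //.
- exact: (@integrable_norm _ _ _ mu `[a, x] _ (Pi ox)).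
- exact: (@integrable_norm _ _ _ mu `[a, x] _ (Si ox)).
Qed.

Let K1 x : 1 <= K x.
Proof. by apply: bielecki_weight_ge1 => t; rewrite addr_ge0. Qed.

(* the left endpoint is included because the induction integrates from it *)
Lemma picard_step n x y : oint a b y -> a <= x -> x <= y ->
  `|(picard n.+1).1 x - (picard n).1 x| <= C / 2 ^+ n * K x /\
  `|(picard n.+1).2 x - (picard n).2 x| <= C / 2 ^+ n * K x.
Proof.
move=> oy; elim: n x => [|n IH] x ax xy.
  rewrite expr0 divr1 /=.
  have z g : \int[mu]_(t in `[a, x]) (g t * cst 0 t) = 0.
    rewrite (@eq_Rintegral _ _ _ mu _ (cst 0)); first by rewrite Rintegral_cst// mul0r.
    by move=> t _; rewrite mulr0.
  rewrite !z !addr0 !subr0 /C.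
  have := K1 x => K1x; have CK : C <= C * K x by rewrite ler_peMr// addr_ge0.
  by split; apply: le_trans CK; rewrite /C ?lerDl ?lerDr.
have sub g : mu.-integrable `[a, y] (EFin \o g) -> mu.-integrable `[a, x] (EFin \o g).
  exact: integrable_segmentS.
have csub k : {within `[a, x], continuous (picard k).1} /\
    {within `[a, x], continuous (picard k).2}.
  have [c1 c2] := picard_continuous k oy.
  have axay : `[a, x] `<=` `[a, y] by apply: subset_itv; rewrite bnd_simp.
  by split; [apply: continuous_subspaceW c1|apply: continuous_subspaceW c2].
have E : C / 2 ^+ n.+1 = C / 2 ^+ n / 2 by rewrite exprSr invfM mulrA.
rewrite E; split.
- have := bielecki_contraction ax (sub _ (mi oy)) (sub _ (Pi oy)) _
    (csub n.+1).2 (csub n).2.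
  move=> /(_ (C / 2 ^+ n)) H.
  have := H (fun t => _) (fun t at_ tx => (IH t at_ (le_trans tx xy)).2).
  rewrite (picardS1 n.+1) (picardS1 n) opprD addrACA subrr add0r; apply.
  by move=> t; rewrite /m lerDl.
- have := bielecki_contraction ax (sub _ (mi oy)) (sub _ (Si oy)) _
    (csub n.+1).1 (csub n).1.
  move=> /(_ (C / 2 ^+ n)) H.
  have := H (fun t => _) (fun t at_ tx => (IH t at_ (le_trans tx xy)).1).
  rewrite (picardS2 n.+1) (picardS2 n) opprD addrACA subrr add0r; apply.
  by move=> t; rewrite /m lerDr.
Qed.

Let U x := limn (fun n => (picard n).1 x).
Let W x := limn (fun n => (picard n).2 x).

Lemma picard_cvg x y : oint a b y -> a <= x -> x <= y ->
  ((picard n).1 x @[n --> \oo] --> U x) /\ ((picard n).2 x @[n --> \oo] --> W x).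
Proof.
move=> oy ax xy; have st n := picard_step n oy ax xy.
split; apply: (@cvgn_of_geometric_steps _ (C * K x)) => n.
- by have [+ _] := st n; rewrite mulrAC.
- by have [_] := st n; rewrite mulrAC.
Qed.

Lemma picard_bound n x y : oint a b y -> a <= x -> x <= y ->
  `|(picard n).1 x| <= 2 * (C * K x) /\ `|(picard n).2 x| <= 2 * (C * K x).
Proof.
move=> oy ax xy; have st k := picard_step k oy ax xy.
split.
- apply: (@norm_le_of_geometric_steps (fun k => (picard k).1 x)) => // k.
  by have [+ _] := st k; rewrite mulrAC.
- apply: (@norm_le_of_geometric_steps (fun k => (picard k).2 x)) => // k.
  by have [_] := st k; rewrite mulrAC.
Qed.

(** The uniform bound 2 C K on the iterates is integrable against |h|, so the
    recursion passes to the limit by dominated convergence. *)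
Let picard_limit (u_ v_ : nat -> R -> R) u v h y : oint a b y ->
  mu.-integrable `[a, y] (EFin \o h) ->
  (forall n, primitive_on a y (u_ n.+1) (fun t => h t * v_ n t)) ->
  (forall n, {within `[a, y], continuous (v_ n)}) ->
  (forall t, a <= t -> t <= y -> u_ n t @[n --> \oo] --> u t) ->
  (forall t, a <= t -> t <= y -> v_ n t @[n --> \oo] --> v t) ->
  (forall n t, a <= t -> t <= y -> `|v_ n t| <= 2 * (C * K t)) ->
  primitive_on a y u (fun t => h t * v t).
Proof.
move=> oy hi pn cv cu cvv bv.
have ay : a <= y by case: oy => /ltW.
have cK : {within `[a, y], continuous (fun t => 2 * (C * K t))}.
  move=> t; apply: cvgM; first exact: cvg_cst.
  apply: cvgM; first exact: cvg_cst.
  exact: (primitive_continuous ay (bielecki_weight_primitive ay (mi oy))).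
have Di : mu.-integrable `[a, y] (EFin \o (fun t => `|h t| * (2 * (C * K t)))).
  by apply: integrable_mul_continuousr => //; exact: (@integrable_norm _ _ _ mu `[a, y]).
have mh : measurable_fun `[a, y] h.
  by apply/measurable_EFinP; exact: (measurable_int mu hi).
have mv : measurable_fun `[a, y] v.
  apply: (measurable_fun_cvg (h := v_)) => [n|t].
    exact: (subspace_continuous_measurable_fun (measurable_itv _) (cv n)).
  by rewrite /= in_itv /= => /andP[]; exact: cvv.
have mhv : measurable_fun `[a, y] (fun t => h t * v t) by exact: measurable_funM.
have dom n t : `[a, y]%classic t -> `|h t * v_ n t| <= `|h t| * (2 * (C * K t)).
  rewrite /= in_itv /= => /andP[xt ty].
  by rewrite normrM ler_wpM2l// bv.
have lim t : `[a, y]%classic t -> h t * v_ n t @[n --> \oo] --> h t * v t.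
  rewrite /= in_itv /= => /andP[xt ty].
  by apply: cvgM; [exact: cvg_cst|exact: cvv].
have ihv : mu.-integrable `[a, y] (EFin \o (fun t => h t * v t)).
  apply: (le_integrable _ _ _ Di) => //; first by apply/measurable_EFinP.
  move=> t ty /=; rewrite lee_fin.
  rewrite [leRHS]ger0_norm; last by apply: le_trans (dom 0%N t ty).
  have /cvg_norm := lim t ty.
  move=> l; rewrite -(cvg_lim _ l)//; apply: limr_le; first exact: (cvgP _ l).
  by apply: nearW => n; exact: dom.
split => // s t xs st ty.
have styx : `[s, t] `<=` `[a, y] by apply: subset_itv; rewrite bnd_simp.
have l1 : u_ n.+1 t - u_ n.+1 s @[n --> \oo] --> u t - u s.
  have ct := cu t (le_trans xs st) ty; have cs := cu s xs (le_trans st ty).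
  by apply: cvgB; [rewrite (cvg_shiftS (fun n => u_ n t))|
                   rewrite (cvg_shiftS (fun n => u_ n s))].
have l2 : \int[mu]_(z in `[s, t]) (h z * v_ n z) @[n --> \oo] -->
    \int[mu]_(z in `[s, t]) (h z * v z).
  apply: fine_cvg; rewrite fineK; last first.
    apply: (@integrable_fin_num _ _ _ mu `[s, t]) => //.
    exact: integrable_segmentS ihv.
  apply: (@dominated_cvg _ _ _ mu `[s, t] _ _ _
    (EFin \o (fun t => `|h t| * (2 * (C * K t))))) => //.
  - move=> n; apply/measurable_EFinP; apply: measurable_funS styx _ => //.
    apply: measurable_funM => //.
    exact: (subspace_continuous_measurable_fun (measurable_itv _) (cv n)).
  - by move=> z /styx zy; apply: cvg_EFin; [exact: nearW|exact: lim].
  - exact: integrable_segmentS Di.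
  - by move=> n z /styx zy /=; rewrite lee_fin; exact: dom.
have E : (fun n => u_ n.+1 t - u_ n.+1 s) =
         (fun n => \int[mu]_(z in `[s, t]) (h z * v_ n z)).
  by apply/funext => n; have [_ ->] := pn n.
by move: l1; rewrite E => l1; exact: (cvg_unique (@Rhausdorff R) l1 l2).
Qed.

Lemma system_exists : exists u w, [/\ u a = ua, w a = wa &
  forall y, oint a b y -> primitive_on a y u (fun t => P t * w t) /\
                          primitive_on a y w (fun t => S t * u t)].
Proof.
have at_a (u_ : nat -> R) l : (forall n, u_ n.+1 = l) -> limn u_ = l.
  move=> E; apply/cvg_lim => //; rewrite -(cvg_shiftS u_).
  by rewrite (_ : (fun n => u_ n.+1) = cst l); [exact: cvg_cst|exact/funext].
exists U, W; split.
- by apply: at_a => n; rewrite picardS1 set_itv1 Rintegral_set1 addr0.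
- by apply: at_a => n; rewrite picardS2 set_itv1 Rintegral_set1 addr0.
move=> y oy; split.
- apply: (@picard_limit (fun n => (picard n).1) (fun n => (picard n).2) U W) => //.
  + exact: Pi.
  + by move=> n; exact: (picard_primitive n oy).1.
  + by move=> n; exact: (picard_continuous n oy).2.
  + by move=> t at_ ty; exact: (picard_cvg oy at_ ty).1.
  + by move=> t at_ ty; exact: (picard_cvg oy at_ ty).2.
  + by move=> n t at_ ty; exact: (picard_bound n oy at_ ty).2.
- apply: (@picard_limit (fun n => (picard n).2) (fun n => (picard n).1) W U) => //.
  + exact: Si.
  + by move=> n; exact: (picard_primitive n oy).2.
  + by move=> n; exact: (picard_continuous n oy).1.
  + by move=> t at_ ty; exact: (picard_cvg oy at_ ty).2.
  + by move=> t at_ ty; exact: (picard_cvg oy at_ ty).1.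
  + by move=> n t at_ ty; exact: (picard_bound n oy at_ ty).1.
Qed.

End Picard.
End LinearSystem.

(** * Zeros of solutions *)

Section SolutionZeros.
Context {R : realType}.
Notation mu := (@lebesgue_measure R).
Implicit Types (a x y s t e : R) (b : \bar R) (f g h u w P S : R -> R).

(** Integrability up to the regular endpoint, from integrability near it and
    local integrability elsewhere. *)
Lemma integrable_regular_left a b c x g : oint a b c -> oint a b x ->
  mu.-integrable (oint a c%:E) (EFin \o g) -> locally_integrable (oint a b) g ->
  mu.-integrable `[a, x] (EFin \o g).
Proof.
move=> oc ox gac lg; have [mg oab _] := lg.
have moab := open_measurable oab.
pose z := Num.max c x.
have oz : oint a b z.
  by rewrite /z; case: (leP c x) => _.
have Uab : `]a, c[ `|` `[c, z] `<=` oint a b.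
  move=> t [|]; rewrite /= in_itv /= => /andP[h1 h2].
    split=> //; case: oc => _; apply: le_lt_trans; rewrite lee_fin; exact: ltW.
  exact: (oint_between oc oz).
have xU : `]a, x] `<=` `]a, c[ `|` `[c, z].
  move=> t; rewrite /= !in_itv /= => /andP[at_ tx].
  have [ct|tc] := leP c t; [right|left]; rewrite ?at_//=.
  by rewrite /z le_max tx orbT.
have mgx : measurable_fun `]a, x] g by apply: measurable_funS mg => // t /xU; exact: Uab.
apply/integrableP; split; first by apply/measurable_EFinP/measurable_fun_itv_obnd_cbndP.
rewrite -integral_itv_obnd_cbnd; last first.
  by apply: measurableT_comp => //; apply/measurable_EFinP.
have mU : measurable (`]a, c[%classic `|` `[c, z]%classic : set R) by exact: measurableU.
have mgU : measurable_fun (`]a, c[ `|` `[c, z]) (fun t => `|(EFin \o g) t|%E).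
  apply: measurableT_comp => //; apply/measurable_EFinP.
  exact: measurable_funS mg.
apply: (@le_lt_trans _ _ (\int[mu]_(t in `]a, c[ `|` `[c, z]) `|(EFin \o g) t|)%E).
  by apply: ge0_subset_integral => //.
rewrite ge0_integral_setU//; last first.
  apply/disj_setPS => t [] /=; rewrite !in_itv /= => /andP[_ tc] /andP[ct _].
  by move: ct; rewrite leNgt tc.
apply: lte_add_pinfty.
  by move: gac; rewrite oint_itv => /integrableP[].
by have /integrableP[] := locally_integrable_segment oc oz lg.
Qed.

(** Neighbourhoods that contain no zero except possibly their centre cover the
    segment; the centres of a finite subcover contain all the zeros. *)
Lemma finite_isolated_zeros f x y :
  (forall t, x <= t -> t <= y -> exists2 d, 0 < d &
     forall s, x <= s -> s <= y -> `|s - t| < d -> f s = 0 -> s = t) ->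
  finite_set [set t | [/\ x <= t, t <= y & f t = 0]].
Proof.
move=> H.
have /choice[d Hd] : forall t, exists d, x <= t -> t <= y -> 0 < d /\
    forall s, x <= s -> s <= y -> `|s - t| < d -> f s = 0 -> s = t.
  move=> t; case: (pselect (x <= t /\ t <= y)) => [[xt ty]|n].
    by have [d d0 Hd] := H t xt ty; exists d.
  by exists 1 => xt ty; case: n.
have := @segment_compact _ x y; rewrite compact_cover.
move=> /(_ R `[x, y]%classic (fun t => ball t (d t)))[].
- by move=> t _; exact: ball_open.
- move=> t xyt; exists t => //; apply: ballxx.
  by move: xyt; rewrite /= in_itv /= => /andP[xt ty]; case: (Hd t xt ty).
move=> D Dxy Dcov.
apply: (@finite_subfset _ D).
move=> s [xs sy fs].
have [|t /= tD] := Dcov s; first by rewrite /= in_itv /= xs.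
have := Dxy t tD; rewrite inE /= in_itv /= => /andP[xt ty].
have [_ Ht] := Hd t xt ty.
by rewrite /ball /= distrC => st; rewrite (Ht s xs sy st fs).
Qed.

Lemma primitive_constant f x y : x <= y -> primitive_on x y f (fun=> 0) -> f y = f x.
Proof.
move=> xy [_ fg]; apply/eqP; rewrite -subr_eq0 fg// Rintegral_cst// mul0r //.
Qed.

Lemma wronskian_constant P S u1 w1 u2 w2 x y : x <= y ->
  primitive_on x y u1 (fun t => P t * w1 t) ->
  primitive_on x y w1 (fun t => S t * u1 t) ->
  primitive_on x y u2 (fun t => P t * w2 t) ->
  primitive_on x y w2 (fun t => S t * u2 t) ->
  u1 y * w2 y - w1 y * u2 y = u1 x * w2 x - w1 x * u2 x.
Proof.
move=> xy pu1 pw1 pu2 pw2.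
have p := primitiveD (primitiveM xy pu1 pw2) (primitiveZ (-1) (primitiveM xy pw1 pu2)).
have := primitive_constant xy (eq_primitive (g' := fun=> 0) _ p).
rewrite !mulN1r; apply => t _ _; ring.
Qed.

(** At a zero of u the quasi-derivative w does not vanish, so u' = P w keeps a
    sign nearby and the zero is isolated. *)
Lemma finite_zeros_segment P S u w a y : a <= y ->
  primitive_on a y u (fun t => P t * w t) ->
  primitive_on a y w (fun t => S t * u t) ->
  (forall t, a < t -> t <= y -> 0 < P t) -> u a != 0 ->
  (forall t, a <= t -> t <= y -> u t = 0 -> w t != 0) ->
  finite_set [set t | [/\ a <= t, t <= y & u t = 0]].
Proof.
move=> ay pu pw P0 ua uw.
apply: finite_isolated_zeros => t at_ ty.
have [ut|ut] := eqVneq (u t) 0; last first.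
  have [|d d0 Hd] := within_continuousP (primitive_continuous ay pu) at_ ty (e := `|u t|).
    by rewrite normr_gt0.
  exists d => // s as_ sy /(Hd s as_ sy) + us.
  by rewrite us sub0r normrN ltxx.
have wt := uw t at_ ty ut.
have [|d d0 Hd] := within_continuousP (primitive_continuous ay pw) at_ ty (e := `|w t|).
  by rewrite normr_gt0.
have at' : a < t.
  by rewrite lt_neqAle at_ andbT; apply: contra_neq ua => ->.
exists (Num.min d (t - a)); first by rewrite lt_min d0 subr_gt0.
move=> s as_ sy; rewrite lt_min => /andP[sd sa] us.
apply/eqP; apply: contraT => st.
(* P w keeps a constant sign between s and t, so u cannot vanish at both *)
have mono c x z : a < x -> x < z -> z <= y -> (forall v, x <= v -> v <= z -> 0 < c * w v) ->
    c * u x < c * u z.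
  move=> ax xz zy cw.
  apply: (primitive_gt0 xz (primitiveZ c (primitiveS (ltW ax) zy pu))) => v xv vz.
  rewrite mulrCA mulr_gt0 ?cw// P0//; first exact: lt_le_trans xv.
  exact: le_trans zy.
have sgn v : a <= v -> v <= y -> `|v - t| < d -> 0 < w t * w v.
  move=> av vy /(Hd v av vy); rewrite ltr_norml => /andP[h1 h2].
  have [w0|w0|/eqP] := ltgtP (w t) 0; last by rewrite (negbTE wt).
    by rewrite nmulr_rgt0//; move: h2; rewrite ltr0_norm//; lra.
  by rewrite pmulr_rgt0//; move: h1; rewrite gtr0_norm//; lra.
have [st'|ts|/eqP] := ltgtP s t; last by rewrite (negbTE st).
- have := @mono (w t) s t _ st' ty; rewrite us ut mulr0 ltxx; apply.
    by move: sa; rewrite ltr0_norm ?subr_lt0//; lra.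
  move=> v sv vt; apply: sgn; [lra|lra|].
  by move: sd; rewrite ltr0_norm ?subr_lt0// ler0_norm ?subr_le0//; lra.
- have := @mono (w t) t s at' ts sy; rewrite us ut mulr0 ltxx; apply.
  move=> v tv vs; apply: sgn; [lra|lra|].
  by move: sd; rewrite gtr0_norm ?subr_gt0// ger0_norm ?subr_ge0//; lra.
Qed.

End SolutionZeros.

(** * The two comparison identities *)

Section Comparison.
Context {R : realType}.
Notation mu := (@lebesgue_measure R).
Implicit Types (x y s t e : R) (f g h : R -> R).

Lemma primitive_inv f g x y : x <= y -> primitive_on x y f g ->
  (forall t, x <= t -> t <= y -> f t != 0) ->
  primitive_on x y (fun t => (f t)^-1) (fun t => - (f t) ^- 2 * g t).
Proof.
move=> xy pfg f0.
apply: (primitive_comp (F := fun z => z^-1) (F' := fun z => - z ^- 2) xy pfg) => t xt ty.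
  have ft := f0 t xt ty.
  apply: DeriveDef; first exact: (derivableV ft (@derivable_id _ _ _ _)).
  by rewrite (deriveV ft (@derivable_id _ _ _ _)) derive_id /GRing.scale /= mulr1.
apply: cvgN; apply: cvgV; first by rewrite expf_neq0// f0.
exact: exprn_continuous.
Qed.

(** [p0], [P1], [S0], [S1], [phi] stand for p_0, 1/p_1, q_0 - E r, q_1 - E r and
    v_0 / u_0. *)
Variables (p0 P1 S0 S1 u0 w0 phi u w : R -> R) (x y : R).
Hypothesis xy : x <= y.
Hypothesis pu0 : primitive_on x y u0 (fun t => (p0 t)^-1 * w0 t).
Hypothesis pw0 : primitive_on x y w0 (fun t => S0 t * u0 t).
Hypothesis pphi : primitive_on x y phi (fun t => (p0 t * u0 t ^+ 2)^-1).
Hypothesis pu : primitive_on x y u (fun t => P1 t * w t).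
Hypothesis pw : primitive_on x y w (fun t => S1 t * u t).
Hypothesis p0_gt0 : forall t, x <= t -> t <= y -> 0 < p0 t.
Hypothesis u0_gt0 : forall t, x <= t -> t <= y -> 0 < u0 t.
Hypothesis phi_gt0 : forall t, x <= t -> t <= y -> 0 < phi t.

(* the two quantities that tend to 0, and the one compared with - 1 / 4;
   phi u_0 is v_0 *)
Let e1 t := p0 t * (phi t * u0 t) * w0 t * ((p0 t)^-1 - P1 t).
Let e2 t := p0 t * ((p0 t)^-1 - P1 t).
Let Q t := p0 t * (phi t * u0 t) ^+ 2 *
  (u0 t ^+ 2 * (S1 t - S0 t) + w0 t ^+ 2 * ((p0 t)^-1 - P1 t)).

(* h = (sqrt (u_0 v_0))' p_0 / sqrt (u_0 v_0): for p_1 = p_0 it solves the Riccati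
   equation of the critical perturbation Q = - 1 / 4, whose positive solution is
   sqrt (u_0 v_0) *)
Let h t := w0 t / u0 t + (2 * u0 t ^+ 2 * phi t)^-1.

Let pi0 : primitive_on x y (fun t => (u0 t)^-1)
  (fun t => - (u0 t) ^- 2 * ((p0 t)^-1 * w0 t)).
Proof. by apply: primitive_inv => // t xt ty; rewrite gt_eqF ?u0_gt0. Qed.

(** This is Jacobi's transformation of the quadratic form of tau_1 - E: the
    derivative of u w - h u^2 is (w - h u)^2 / p_1 + (S_1 - h' - h^2 / p_1) u^2, and
    the last bracket is, up to the positive factor 1 / (p_0 u_0^4 phi^2), what
    remains of the criterion. *)
Lemma picone_primitive :
  primitive_on x y (fun t => u t * w t - h t * u t ^+ 2)
    (fun t => P1 t * (w t - h t * u t) ^+ 2 +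
       (Q t + e1 t + 1 / 4 + e2 t / 4) * (p0 t * u0 t ^+ 4 * phi t ^+ 2)^-1 * u t ^+ 2).
Proof.
have pj : primitive_on x y (fun t => (phi t)^-1)
    (fun t => - (phi t) ^- 2 * (p0 t * u0 t ^+ 2)^-1).
  by apply: primitive_inv => // t xt ty; rewrite gt_eqF ?phi_gt0.
have ph := primitiveD (primitiveM xy pw0 pi0)
  (primitiveZ (1/2) (primitiveM xy (primitiveM xy pi0 pi0) pj)).
have := primitiveD (primitiveM xy pu pw)
  (primitiveZ (-1) (primitiveM xy ph (primitiveM xy pu pu))).
move=> p; apply: eq_primitivel (eq_primitive _ p) => t xt ty /=.
- have := lt0r_neq0 (u0_gt0 xt ty); have := lt0r_neq0 (phi_gt0 xt ty).
  by rewrite /h => f0 v0; field; rewrite f0.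
- have := lt0r_neq0 (u0_gt0 xt ty); have := lt0r_neq0 (phi_gt0 xt ty).
  have := lt0r_neq0 (p0_gt0 xt ty).
  by rewrite /h /Q /e1 /e2 => p0' f0 v0; field; rewrite f0 v0.
Qed.

(** Here rho = d / y for y = u / u_0 and d = phi (u_0 w - w_0 u). In the variable
    log phi it solves rho' = Q + (1 + 2 e1) rho - (1 - e2) rho^2, whose right-hand
    side has discriminant 1 + 4 Q when e1 = e2 = 0. *)
Lemma riccati_primitive : (forall t, x <= t -> t <= y -> u t != 0) ->
  primitive_on x y (fun t => phi t * (u0 t ^+ 2 * (w t / u t) - u0 t * w0 t))
   (fun t => let rho := phi t * (u0 t ^+ 2 * (w t / u t) - u0 t * w0 t) in
      (p0 t * u0 t ^+ 2)^-1 / phi t *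
      (Q t + (1 + 2 * e1 t) * rho - (1 - e2 t) * rho ^+ 2)).
Proof.
move=> u_neq0.
have piu := primitive_inv xy pu u_neq0.
have := primitiveM xy pphi (primitiveD
  (primitiveM xy (primitiveM xy pu0 pu0) (primitiveM xy pw piu))
  (primitiveZ (-1) (primitiveM xy pu0 pw0))).
move=> p; apply: eq_primitivel (eq_primitive _ p) => t xt ty /=.
- by ring.
- have := lt0r_neq0 (u0_gt0 xt ty); have := lt0r_neq0 (phi_gt0 xt ty).
  have := lt0r_neq0 (p0_gt0 xt ty); have := u_neq0 t xt ty.
  by rewrite /Q /e1 /e2 => u' p0' f0 v0; field; rewrite ?p0' ?f0 ?v0 ?u'.
Qed.

End Comparison.

(** * Behaviour at the right endpoint *)

Section RightEnd.
Context {R : realType}.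
Notation mu := (@lebesgue_measure R).
Implicit Types (a c x y s t e : R) (b : \bar R) (f g h : R -> R).

Lemma left_end_near a b (A : set R) : (a%:E < b)%E -> left_end b A ->
  exists2 c, oint a b c & forall x, oint c b x -> A x.
Proof.
case: b => [b| |] //; rewrite /left_end /oint.
- rewrite lte_fin => ab -[e /= e0 H].
  exists (Num.max ((a + b) / 2) (b - e / 2)).
    rewrite /= lte_fin lt_max gt_max; split; first by apply/orP; left; lra.
    by apply/andP; split; lra.
  move=> x [cx]; rewrite lte_fin => xb; apply: H => //=.
  by move: cx; rewrite gt_max => /andP[_ bx]; rewrite gtr0_norm ?subr_gt0//; lra.
- move=> _ [M [_ H]]; exists (Num.max (a + 1) M).
    by rewrite /= ltry lt_max ltrDl ltr01.
  by move=> x [+ _]; rewrite gt_max => /andP[_ Mx]; exact: H.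
Qed.

Lemma oint_max a b c d : oint a b c -> oint a b d -> oint a b (Num.max c d).
Proof. by move=> oc od; case: (leP c d). Qed.

Lemma oint_maxl c d b t : oint (Num.max c d) b t -> oint c b t /\ oint d b t.
Proof. by move=> [+ tb]; rewrite gt_max => /andP[ct dt]. Qed.

Lemma oint_trans a b c t : oint a b c -> oint c b t -> oint a b t.
Proof. by move=> [ac _] [ct tb]; split=> //; exact: lt_trans ct. Qed.

Lemma limf_esup_lt_near (f : R -> R) a b (m : R) : (a%:E < b)%E ->
  (limf_esup (EFin \o f) (left_end b) < m%:E)%E ->
  exists2 e, 0 < e & exists2 c, oint a b c & forall x, oint c b x -> f x <= m - e.
Proof.
move=> ab; rewrite limf_esupE => /ereal_inf_lt[_ [A FA <-] supA].
have [c oc cA] := left_end_near ab FA.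
have fA x : oint c b x -> ((f x)%:E <= ereal_sup [set (EFin \o f) z | z in A])%E.
  by move=> ox; apply: ereal_sup_ubound; exists x => //; exact: cA.
case: (ereal_sup _) supA fA => [s| |] // sm fA.
  exists (m - s); first by rewrite subr_gt0 -lte_fin.
  by exists c => // x /fA; rewrite lee_fin subKr.
by exists 1 => //; exists c => // x /fA.
Qed.

Lemma limf_einf_gt_near (f : R -> R) a b (m : R) : (a%:E < b)%E ->
  (m%:E < limf_einf (EFin \o f) (left_end b))%E ->
  exists2 e, 0 < e & exists2 c, oint a b c & forall x, oint c b x -> m + e <= f x.
Proof.
move=> ab; rewrite /limf_einf lteNr => H.
have [|e e0 [c oc He]] := @limf_esup_lt_near (fun x => - f x) a b (- m) ab.
  exact: H.
by exists e => //; exists c => // x /He; lra.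
Qed.

Lemma cvg0_left_end_near (f : R -> R) a b e : (a%:E < b)%E -> 0 < e ->
  f x @[x --> left_end b] --> (0 : R) ->
  exists2 c, oint a b c & forall x, oint c b x -> `|f x| <= e.
Proof.
move=> ab e0 f0.
have [|c oc H] := @left_end_near a b (fun x => `|f x| < e) ab.
  apply: (f0 [set z | `|z| < e]); exists e => //= z.
  by rewrite /ball_ /= sub0r normrN.
by exists c => // x /H /ltW.
Qed.

Lemma oint_exhaustion a b : (a%:E < b)%E -> exists y_ : nat -> R,
  [/\ {homo y_ : m n / (m <= n)%N >-> m <= n}, forall n, oint a b (y_ n) &
      forall t, oint a b t -> exists n, t < y_ n].
Proof.
case: b => [b| |] // ; rewrite /oint ?lte_fin => ab.
- exists (fun n => b - (b - a) / n.+2%:R); split.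
  + move=> m n mn; rewrite lerD2l lerN2 ler_wpM2l ?subr_ge0 ?(ltW ab)//.
    by rewrite lef_pV2 ?posrE// ler_nat.
  + move=> n /=; rewrite lte_fin.
    have ba : 0 < b - a by rewrite subr_gt0.
    have h1 : 0 < (b - a) / n.+2%:R by rewrite divr_gt0.
    have h2 : (b - a) / n.+2%:R < b - a by rewrite ltr_pdivrMr// ltr_pMr// ltr1n.
    by move: h1 h2; set z := _ / _ => h1 h2; split; lra.
  + move=> t /= [at_]; rewrite lte_fin => tb.
    exists (Num.truncn ((b - a) / (b - t))).
    set n := Num.truncn _.
    have := truncnS_gt ((b - a) / (b - t)); rewrite -/n => Hn.
    have bt : 0 < b - t by rewrite subr_gt0.
    have : (b - a) / (b - t) < n.+2%:R by apply: lt_trans Hn _; rewrite ltr_nat.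
    rewrite ltr_pdivrMr// mulrC => H.
    have : (b - a) / n.+2%:R < b - t by rewrite ltr_pdivrMr.
    by set z := _ / _ => hz; lra.
- exists (fun n => a + n.+1%:R); split.
  + by move=> m n mn; rewrite lerD2l ler_nat.
  + by move=> n; rewrite /= ltry ltrDl.
  + move=> t [at_ _]; exists (Num.truncn (t - a)).
    by have := truncnS_gt (t - a); set z := _%:R => hz; lra.
Qed.

(** Here v is the second solution obtained from u by reduction of order, and
    phi = v / u is the integral of 1 / (p u^2) from a. *)
Section ReductionOfOrder.
Variables (a : R) (b : \bar R) (p u v : R -> R).
Hypothesis p0 : forall x, oint a b x -> 0 < p x.
Hypothesis u0 : forall x, oint a b x -> 0 < u x.
Hypothesis cu : {in oint a b, continuous u}.
Hypothesis lp : locally_integrable (oint a b) (fun x => (p x)^-1).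
Let k t := (p t * u t ^+ 2)^-1.
Hypothesis hv : forall x, oint a b x ->
  ((v x)%:E = (u x)%:E * \int[mu]_(t in oint a x%:E) (k t)%:E)%E.

Lemma inv_pu2_gt0 t : oint a b t -> 0 < k t.
Proof. by move=> ot; rewrite invr_gt0 mulr_gt0 ?p0// exprn_gt0// u0. Qed.

Lemma inv_pu2_locally_integrable : locally_integrable (oint a b) k.
Proof.
have -> : k = (fun t => (p t)^-1 * (u t ^+ 2)^-1).
  by apply/funext => t; rewrite /k invfM.
apply: locally_integrableM => // t to_; apply: cvgV.
  by rewrite expf_neq0// gt_eqF// u0//; rewrite inE in to_.
by apply: cvgM; exact: cu.
Qed.

Lemma phi_integral x : oint a b x ->
  mu.-integrable `]a, x[ (EFin \o k) /\ v x / u x = \int[mu]_(t in `]a, x[) k t.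
Proof.
move=> ox; have [mk oab _] := inv_pu2_locally_integrable.
have xab : `]a, x[ `<=` oint a b.
  move=> t; rewrite /= in_itv /= => /andP[at_ tx]; split => //.
  by case: ox => _; apply: le_lt_trans; rewrite lee_fin ltW.
have mkx : measurable_fun `]a, x[ (EFin \o k).
  by apply/measurable_EFinP; apply: measurable_funS mk => //; exact: open_measurable.
have u0x := u0 ox.
have hvx := hv ox; rewrite oint_itv in hvx.
have I0 : (0 <= \int[mu]_(t in `]a, x[) (k t)%:E)%E.
  by apply: integral_ge0 => t /xab tab; rewrite lee_fin ltW// inv_pu2_gt0.
move: I0 hvx; rewrite /Rintegral.
case E : (\int[mu]_(t in `]a, x[) (k t)%:E)%E => [I| |] I0 vI //.
- split.
    apply/integrableP; split => //.
    rewrite (_ : (\int[mu]_(t in _) _)%E = I%:E) ?ltry// -E.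
    apply: eq_integral => t /set_mem /xab tab.
    by rewrite /= ger0_norm// ltW// inv_pu2_gt0.
  move: vI; rewrite -EFinM => -[->]; rewrite mulrC mulKf//.
  by rewrite gt_eqF.
- by move: vI; rewrite gt0_muley// lte_fin.
Qed.

Lemma phi_primitive : primitive_in a b (fun t => v t / u t) k.
Proof.
move=> x y ox oy xy; split.
  exact: (locally_integrable_segment ox oy inv_pu2_locally_integrable).
move=> s t xs st ty.
have os := oint_between ox oy xs (le_trans st ty).
have ot := oint_between ox oy (le_trans xs st) ty.
have [is_ ->] := phi_integral os; have [it_ ->] := phi_integral ot.
rewrite (Rintegral_itv_bndo_bndc is_) (Rintegral_itv_bndo_bndc it_).
have [z oz tz] := oint_right ot.
have it' : mu.-integrable `]a, t] (EFin \o k).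
  have [iz _] := phi_integral oz.
  by apply: integrableS iz => //; apply: subset_itv; rewrite bnd_simp.
have as_ : a <= s by case: os => /ltW.
rewrite (Rintegral_itvB it') ?bnd_simp//.
rewrite Rintegral_itv_obnd_cbnd//.
by apply: integrableS it' => //; apply: subset_itv; rewrite bnd_simp.
Qed.

Lemma phi_gt0 x : oint a b x -> 0 < v x / u x.
Proof.
move=> ox; have [z oz zx] := oint_left ox.
apply: (@le_lt_trans _ _ (v z / u z)).
  have [_ ->] := phi_integral oz; apply: Rintegral_ge0 => t.
  rewrite /= in_itv /= => /andP[at_ tz]; apply/ltW/inv_pu2_gt0; split => //.
  by case: oz => _; apply: lt_trans; rewrite lte_fin.
apply: (primitive_gt0 zx (phi_primitive oz ox (ltW zx))) => t zt tx.
by apply: inv_pu2_gt0; exact: (oint_between oz ox).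
Qed.

(** Minimality of u is the divergence of the integral of 1 / (p u^2) at b; it lets
    log phi serve as a time variable that runs to infinity. *)
Lemma phi_unbounded c M : oint a b c ->
  (\int[mu]_(t in oint c b) (k t)%:E = +oo)%E ->
  exists2 x, oint c b x & M < v x / u x.
Proof.
move=> oc Ioo; have cb : (c%:E < b)%E by case: oc.
have [y_ [yh yo yt]] := oint_exhaustion cb.
apply: contrapT => H.
have bnd n : (\int[mu]_(t in `]c, (y_ n)[) (k t)%:E <= M%:E)%E.
  have oy := oint_trans oc (yo n).
  have cy : c <= y_ n by case: (yo n) => /ltW.
  have [iy Ey] := phi_integral oy.
  have yM : v (y_ n) / u (y_ n) <= M.
    by rewrite leNgt; apply/negP => My; apply: H; exists (y_ n).
  apply: (@le_trans _ _ (\int[mu]_(t in `]a, (y_ n)[) (k t)%:E)%E); last first.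
    rewrite -(@fineK _ (\int[mu]_(t in `]a, (y_ n)[) (k t)%:E)%E).
      by rewrite lee_fin; move: yM; rewrite Ey.
    exact: (@integrable_fin_num _ _ _ mu `]a, (y_ n)[).
  apply: ge0_subset_integral => //.
  - exact: (measurable_int mu iy).
  - move=> t; rewrite -oint_itv => -[at_ ty]; rewrite lee_fin ltW// inv_pu2_gt0//.
    by split => //; apply: lt_trans ty _; case: (yo n).
  - by apply: subset_itv; rewrite bnd_simp//; case: oc => /ltW.
have cover : oint c b = \bigcup_n `]c, (y_ n)[%classic.
  apply/seteqP; split=> t.
    move=> ot; have [n tn] := yt t ot; exists n => //.
    by rewrite /= in_itv /= tn andbT; case: ot.
  move=> [n _]; rewrite /= in_itv /= => /andP[ct ty]; split=> //.
  by case: (yo n) => _; apply: lt_trans; rewrite lte_fin.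
have sub n : `]c, (y_ n)[ `<=` oint a b.
  by move=> t ty; apply: (oint_trans oc); rewrite cover; exists n.
have [mk oab _] := inv_pu2_locally_integrable.
have cv : (\int[mu]_(t in `]c, (y_ n)[) (k t)%:E)%E @[n --> \oo] --> +oo%E.
  rewrite -Ioo cover.
  have mono_cvg := @ge0_nondecreasing_set_cvg_integral _ (measurableTypeR R) R
    (fun n => `]c, (y_ n)[%classic) (EFin \o k) mu.
  apply: mono_cvg => //.
  - move=> m n mn; apply/subsetPset; apply: subset_itv; rewrite ?bnd_simp//.
    exact: yh.
  - move=> n; apply/measurable_EFinP; apply: measurable_funS mk => //.
    exact: open_measurable.
  - by move=> n t /sub ot; rewrite lee_fin ltW// inv_pu2_gt0.
have : (+oo <= M%:E)%E.
  rewrite -(cvg_lim _ cv)//; apply: lime_le; first exact: cvgP cv.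
  exact: nearW.
by rewrite leye_eq.
Qed.
End ReductionOfOrder.
End RightEnd.

(** * The oscillation criterion *)

(** For d1 = d2 = 0 the left-hand side is q + 1 / 4 - (x - 1 / 2)^2. The rate
    eta / 6 leaves room for the errors: after they are absorbed, the inequality
    reduces to (1 + x^2) / 3 + x^2 / 6 <= 1 + (x - 1 / 2)^2. *)
Lemma riccati_decay (R : realType) (q d1 d2 eta x : R) : 0 < eta -> eta <= 1 ->
  q <= - (1 / 4) - eta -> `|d1| <= eta / 6 -> `|d2| <= eta / 6 ->
  q + (1 + 2 * d1) * x - (1 - d2) * x ^+ 2 <= - (eta / 6) * (1 + x ^+ 2).
Proof.
move=> eta0 eta1 hq; rewrite !ler_norml => /andP[d1l d1u] /andP[d2l d2u].
(* this sum of squares is (eta / 6) (1 + x^2) - 2 d1 x *)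
have h1 : 0 <= (eta / 6 - d1) / 2 * (1 + x) ^+ 2 + (eta / 6 + d1) / 2 * (1 - x) ^+ 2.
  by apply: addr_ge0; apply: mulr_ge0; rewrite ?sqr_ge0//; lra.
have h2 : 0 <= (eta / 6 - d2) * x ^+ 2 by rewrite mulr_ge0 ?sqr_ge0//; lra.
have h3 : 0 <= (1 - eta) * (x - 1 / 2) ^+ 2 by rewrite mulr_ge0 ?sqr_ge0//; lra.
have h4 : 0 <= eta * (x - 1) ^+ 2 by rewrite mulr_ge0 ?sqr_ge0//; lra.
lra.
Qed.

Section Criterion.
Context {R : realType}.
Notation mu := (@lebesgue_measure R).
Variables (a : R) (b : \bar R) (p0 q0 p1 q1 r : R -> R) (E : R).
Variables (u0 w0 v0 : R -> R).
Hypothesis hab : (a%:E < b)%E.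
Hypothesis hc0 : sl_coeffs a b p0 q0 r.
Hypothesis hc1 : sl_coeffs a b p1 q1 r.
Hypothesis ha1 : regular_left a b p1 q1 r.
Hypothesis hu0 : minimal_solution a b p0 q0 r E u0 w0.
Hypothesis hv0 : forall x, oint a b x ->
  ((v0 x)%:E = (u0 x)%:E * \int[mu]_(t in oint a x%:E) ((p0 t * u0 t ^+ 2)^-1)%:E)%E.

Let Dp x := (p0 x)^-1 - (p1 x)^-1.
Let Q x := p0 x * v0 x ^+ 2 * (u0 x ^+ 2 * (q1 x - q0 x) + w0 x ^+ 2 * Dp x).
Let e1 x := p0 x * v0 x * w0 x * Dp x.
Let e2 x := p0 x * Dp x.
Let phi x := v0 x / u0 x.
Let S0 x := q0 x - E * r x.
Let S1 x := q1 x - E * r x.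

Let p0_gt0 x : oint a b x -> 0 < p0 x.
Proof. by case: hc0 => _ _ _ /(_ x) H /H[]. Qed.

Let p1_gt0 x : oint a b x -> 0 < p1 x.
Proof. by case: hc1 => _ _ _ /(_ x) H /H[]. Qed.

Let u0_gt0 x : oint a b x -> 0 < u0 x.
Proof. by move=> ox; case: hu0 => _ + _; exact. Qed.

Let sys0 : system_in a b (fun t => (p0 t)^-1) S0 u0 w0.
Proof. by apply/(sl_solutionP E u0 w0 hc0); case: hu0 => solu0 _ _. Qed.

Let cu0 : {in oint a b, continuous u0}.
Proof. by move=> t /set_mem ot; exact: primitive_in_continuous sys0.1 ot. Qed.

Let lp0 : locally_integrable (oint a b) (fun x => (p0 x)^-1).
Proof. by case: hc0 => lp _ _ _. Qed.

Let pphi : primitive_in a b phi (fun t => (p0 t * u0 t ^+ 2)^-1).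
Proof. exact: (phi_primitive p0_gt0 u0_gt0 cu0 lp0 hv0). Qed.

Let phi0 x : oint a b x -> 0 < phi x.
Proof. exact: (phi_gt0 p0_gt0 u0_gt0 cu0 lp0 hv0). Qed.

Let phiu0 x : oint a b x -> phi x * u0 x = v0 x.
Proof. by move=> ox; rewrite /phi divfK// gt_eqF// u0_gt0. Qed.

Let rho u w t := phi t * (u0 t ^+ 2 * (w t / u t) - u0 t * w0 t).

Let segment x y t : oint a b x -> oint a b y -> x <= t -> t <= y -> oint a b t.
Proof. exact: oint_between. Qed.

(** The solution with u = 1, w = 0 at the regular endpoint is followed. Beyond c
    the function u w - h u^2 is strictly increasing and vanishes at the zeros of
    u, so u has at most one zero there; before c compactness applies. *)
Lemma nonoscillatory_of_subsolution c : oint a b c ->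
  (forall t, oint c b t -> 0 < Q t + e1 t + 1 / 4 + e2 t / 4) ->
  nonoscillatory a b p1 q1 r E.
Proof.
move=> oc Hc.
have lS := sl_potential_locally_integrable E hc1.
have [lp1 lq1 lr _] := hc1.
have [d [od [ip iq ir]]] := ha1.
have Pi x : oint a b x -> mu.-integrable `[a, x] (EFin \o (fun t => (p1 t)^-1)).
  by move=> ox; exact: (integrable_regular_left od ox).
have Si x : oint a b x -> mu.-integrable `[a, x] (EFin \o S1).
  move=> ox.
  apply: (@integrableB _ _ _ mu `[a, x] _ (EFin \o q1) (EFin \o (fun t => E * r t))) => //.
    exact: (integrable_regular_left od ox).
  apply: (@integrableZl _ _ _ mu `[a, x] _ E (EFin \o r)) => //.
  exact: (integrable_regular_left od ox).
have [u [w [ua wa uw]]] := system_exists 1 0 Pi Si.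
(* the Wronskian with this second solution keeps (u, w) away from (0, 0) *)
have [u' [w' [ua' wa' uw']]] := system_exists 0 1 Pi Si.
have nz t : oint a b t -> (u t != 0) || (w t != 0).
  move=> ot; have at_ : a <= t by case: ot => /ltW.
  have := wronskian_constant at_ (uw t ot).1 (uw t ot).2 (uw' t ot).1 (uw' t ot).2.
  rewrite ua wa ua' wa' mul1r mul0r subr0 -negb_and.
  by apply: contra_eqN => /andP[/eqP -> /eqP ->]; rewrite !mul0r subr0 eq_sym oner_neq0.
have sys1 : system_in a b (fun t => (p1 t)^-1) S1 u w.
  by split=> x y ox oy xy; [apply: primitiveS (uw y oy).1|apply: primitiveS (uw y oy).2];
    rewrite ?lexx//; case: ox => /ltW.
have solu : sl_solution a b p1 q1 r E u w by apply/(sl_solutionP E u w hc1).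
have fin y : oint a b y -> finite_set [set t | [/\ a <= t, t <= y & u t = 0]].
  move=> oy; have ay : a <= y by case: oy => /ltW.
  apply: (finite_zeros_segment ay (uw y oy).1 (uw y oy).2).
  - move=> t at_ ty; rewrite invr_gt0; apply: p1_gt0; split => //.
    by case: oy => _; apply: le_lt_trans; rewrite lee_fin.
  - by rewrite ua oner_neq0.
  - move=> t; rewrite le_eqVlt => /orP[/eqP <-|at_] ty ut.
      by move: ua; rewrite ut => /eqP; rewrite eq_sym oner_eq0.
    have : oint a b t.
      by split => //; case: oy => _; apply: le_lt_trans; rewrite lee_fin.
    by move/nz; rewrite ut eqxx.
have uniq x y : oint c b x -> x < y -> oint c b y -> u x = 0 -> u y != 0.
  move=> ox xy oy ux; apply/negP => /eqP uy.
  have ox' := oint_trans oc ox; have oy' := oint_trans oc oy.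
  have xy' := ltW xy.
  have seg t : x <= t -> t <= y -> oint a b t by exact: segment.
  have G := picone_primitive xy' (sys0.1 x y ox' oy' xy') (sys0.2 x y ox' oy' xy')
    (pphi ox' oy' xy') (sys1.1 x y ox' oy' xy') (sys1.2 x y ox' oy' xy')
    (fun t xt ty => p0_gt0 (seg t xt ty)) (fun t xt ty => u0_gt0 (seg t xt ty))
    (fun t xt ty => phi0 (seg t xt ty)).
  have := primitive_gt0 xy G; rewrite ux uy !mul0r expr0n /= !mulr0 subrr ltxx.
  move=> H; suff : false by []; apply: H => t xt ty; have ot := seg t xt ty.
  have p1t : 0 < (p1 t)^-1 by rewrite invr_gt0 p1_gt0.
  have Bt := Hc t (oint_between ox oy xt ty).
  set B := (X in _ + X * _ * _).
  have -> : B = Q t + e1 t + 1 / 4 + e2 t / 4.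
    rewrite /B /Q /e1 /e2 /Dp -(phiu0 ot) /S1 /S0; ring.
  set k := (_ * u0 t ^+ 4 * _)^-1.
  have k0 : 0 < k by rewrite invr_gt0; apply: mulr_gt0;
    [apply: mulr_gt0; [exact: p0_gt0|exact/exprn_gt0/u0_gt0]|exact/exprn_gt0/phi0].
  have sq0 z : 0 <= (p1 t)^-1 * z ^+ 2 by rewrite mulr_ge0 ?sqr_ge0// ltW.
  have [ut|ut] := eqVneq (u t) 0; last first.
    apply: ltr_wpDl; first exact: sq0.
    apply: mulr_gt0; first exact: mulr_gt0.
    by rewrite lt0r sqrf_eq0 ut sqr_ge0.
  have /orP[|wt] := nz t ot; first by rewrite ut eqxx.
  rewrite ut expr0n /= !mulr0 addr0 subr0; apply: mulr_gt0 => //.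
  by rewrite lt0r sqrf_eq0 wt sqr_ge0.
exists u, w; split => //.
  (* a lies outside (a, b), but u is nonzero near a by continuity *)
  have ac : a < c by case: oc.
  have [//|d' d'0 Hd] := within_continuousP
    (primitive_continuous (ltW ac) (uw c oc).1) (lexx a) (ltW ac) (e := 1).
  pose x := Num.min c (a + d' / 2).
  have ax : a < x by rewrite lt_min ac ltrDl divr_gt0.
  have xc : x <= c by rewrite ge_min lexx.
  exists x.
    by split => //; case: oc => _; apply: le_lt_trans; rewrite lee_fin.
  have xd : x <= a + d' / 2 by rewrite ge_min lexx orbT.
  have := Hd x (ltW ax) xc; rewrite gtr0_norm ?subr_gt0// ua => /(_ _) H ux.
  have : `|u x - 1| < 1 by apply: H; lra.
  by rewrite ux sub0r normrN normr1 ltxx.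
case: (pselect (exists2 z, oint c b z & u z = 0)) => [[z oz uz]|none].
  apply: (@sub_finite_set _ _ ([set t | [/\ a <= t, t <= c & u t = 0]] `|` [set z])).
    move=> t /= [ot ut]; have [tc|ct] := leP t c; [left|right].
      by split=> //; case: ot => /ltW.
    have ot' : oint c b t by split => //; case: ot.
    have [tz|zt|//] := ltgtP t z.
      by have := uniq t z ot' tz oz ut; rewrite uz eqxx.
    by have := uniq z t oz zt ot' uz; rewrite ut eqxx.
  by rewrite finite_setU; split; [exact: fin|exact: finite_set1].
apply: sub_finite_set (fin c oc) => t [ot ut]; split => //; first by case: ot => /ltW.
rewrite leNgt; apply/negP => ct; apply: none; exists t => //.
by split => //; case: ot.
Qed.

Let bound_of_finite (A : set R) : finite_set A -> A `<=` oint a b ->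
  exists2 c, oint a b c & forall t, oint c b t -> ~ A t.
Proof.
move=> /finite_seqP[s ->] sab.
have [c0 oc0 _] : exists2 c, oint a b c & True.
  by have [c [oc _]] := ha1; exists c.
have [c oc Hc] : exists2 c, oint a b c & forall t, t \in s -> t <= c.
  elim: s sab => [|z s IH] sab; first by exists c0.
  have [|c oc Hc] := IH; first by move=> t ts; apply: sab; rewrite /= inE ts orbT.
  exists (Num.max c z); first by apply: oint_max => //; apply: sab; rewrite /= mem_head.
  move=> t; rewrite inE le_max => /orP[/eqP ->|/Hc ->//].
  by rewrite lexx orbT.
by exists c => // t [ct _] /= /Hc; rewrite leNgt ct.
Qed.

(** If u had no zeros near b, then rho would be defined there and
    atan rho + (eta / 6) log phi nonincreasing, although atan is bounded and phi
    tends to infinity: in the variable log phi the Riccati equation blows up in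
    finite time. *)
Lemma oscillatory_of_decay eta c0 : 0 < eta -> eta <= 1 -> oint a b c0 ->
  (forall t, oint c0 b t ->
     [/\ Q t <= - (1 / 4) - eta, `|e1 t| <= eta / 6 & `|e2 t| <= eta / 6]) ->
  oscillatory a b p1 q1 r E.
Proof.
move=> eta0 eta1 oc0 H0 [u [w [solu _ finu]]].
have sys1 := (sl_solutionP E u w hc1).1 solu.
have [c1 oc1 noz] : exists2 c, oint a b c & forall t, oint c b t -> u t != 0.
  have [|c1 oc1 Hc1] := bound_of_finite finu; first by move=> t [].
  exists c1 => // t ot; apply/negP => /eqP ut; apply: (Hc1 t ot); split => //.
  exact: oint_trans ot.
have [_ _ [c2 [oc2 Ioo]]] := hu0.
pose c := Num.max c0 c1.
have oc : oint a b c by exact: oint_max.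
have [x ox cx] := oint_right oc.
have ox' : oint c b x by split => //; case: ox.
pose L t := atan (rho u w t) + eta / 6 * ln (phi t).
have Ldec y : oint c b y -> x <= y -> L y <= L x.
  move=> oy xy.
  have oy' := oint_trans oc oy.
  have seg t : x <= t -> t <= y -> oint a b t by exact: segment.
  have segc t : x <= t -> t <= y -> oint c b t by exact: oint_between.
  have u_neq0 t : x <= t -> t <= y -> u t != 0.
    by move=> xt ty; apply: noz; case: (oint_maxl (segc t xt ty)).
  have prho := riccati_primitive xy (sys0.1 x y ox oy' xy) (sys0.2 x y ox oy' xy)
    (pphi ox oy' xy) (sys1.1 x y ox oy' xy) (sys1.2 x y ox oy' xy)
    (fun t xt ty => p0_gt0 (seg t xt ty)) (fun t xt ty => u0_gt0 (seg t xt ty))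
    (fun t xt ty => phi0 (seg t xt ty)) u_neq0.
  have patan := primitive_comp (F := atan) (F' := fun z => (1 + z ^+ 2)^-1) xy prho
    (fun t _ _ => is_derive1_atan _) _.
  have pln := primitive_comp (F := @ln R) (F' := fun z => z^-1) xy (pphi ox oy' xy)
    (fun t xt ty => is_derive1_ln (phi0 (seg t xt ty))) _.
  apply: (primitive_le0 xy (primitiveD (patan _) (primitiveZ (eta / 6) (pln _)))) => t xt ty.
  - apply: cvgV; first by rewrite gt_eqF// ltr_pwDl// sqr_ge0.
    by apply: cvgD; [exact: cvg_cst|exact: exprn_continuous].
  - by apply: cvgV; [rewrite gt_eqF// phi0//; exact: seg|exact: cvg_id].
  rewrite /=; have ot := seg t xt ty.
  have [oc0t _] := oint_maxl (segc t xt ty).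
  have [HQ H1 H2] := H0 t oc0t.
  pose rh := rho u w t.
  have decay := riccati_decay rh eta0 eta1 HQ H1 H2.
  have k0 : 0 < (p0 t * u0 t ^+ 2)^-1 / phi t.
    by rewrite divr_gt0 ?phi0// invr_gt0 mulr_gt0 ?p0_gt0// exprn_gt0// u0_gt0.
  have r0 : 0 < 1 + rh ^+ 2 by rewrite ltr_pwDl// sqr_ge0.
  have NE : p0 t * (phi t * u0 t) ^+ 2 * (u0 t ^+ 2 * (S1 t - S0 t) + w0 t ^+ 2 * Dp t) +
      (1 + 2 * (p0 t * (phi t * u0 t) * w0 t * Dp t)) * rh - (1 - p0 t * Dp t) * rh ^+ 2 =
      Q t + (1 + 2 * e1 t) * rh - (1 - e2 t) * rh ^+ 2.
    by rewrite phiu0// /Q /e1 /e2 /S0 /S1; ring.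
  rewrite NE -/(rho u w t) -/rh.
  move: decay k0; set N := Q t + _ - _; set k := (p0 t * u0 t ^+ 2)^-1 => decay k0.
  have -> : (1 + rh ^+ 2)^-1 * (k / phi t * N) + eta / 6 * ((phi t)^-1 * k) =
      k / phi t * ((N + eta / 6 * (1 + rh ^+ 2)) / (1 + rh ^+ 2)).
    by have := lt0r_neq0 r0; have := lt0r_neq0 (phi0 ot) => f0 r0'; field; rewrite r0' f0.
  rewrite pmulr_rle0// ler_pdivrMr// mul0r; lra.
have [y oy My] := phi_unbounded p0_gt0 u0_gt0 cu0 lp0 hv0
  (expR ((L x + pi / 2) / (eta / 6)) + phi x) oc2 Ioo.
have oy' := oint_trans oc2 oy.
have [xy|yx] := leP x y; last first.
  have : phi y < phi x.
    apply: (primitive_gt0 yx (pphi oy' ox (ltW yx))) => t yt tx.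
    exact: inv_pu2_gt0 (segment oy' ox yt tx).
  by have := expR_gt0 ((L x + pi / 2) / (eta / 6)); move: My; rewrite -/(phi y); lra.
have oyc : oint c b y by split; [exact: lt_le_trans xy|case: oy].
have k0 : 0 < eta / 6 by lra.
have : (L x + pi / 2) / (eta / 6) < ln (phi y).
  rewrite -ltr_expR lnK ?posrE ?phi0//; apply: lt_trans My.
  by rewrite ltrDl phi0.
rewrite ltr_pdivrMr// mulrC.
have := Ldec y oyc xy; have := atan_gtNpi2 (rho u w y); rewrite /L.
lra.
Qed.

End Criterion.

(* w0 is the quasi-derivative p0 u0'. The identity defining v0 is read in the
   extended reals, so it includes the finiteness of the integral. *)
Theorem theorem2p1 (R : realType) (a : R) (b : \bar R) (hab : (a%:E < b)%E)
  (p0 q0 p1 q1 r : R -> R) (E : R)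
  (hc0 : sl_coeffs a b p0 q0 r) (hc1 : sl_coeffs a b p1 q1 r)
  (ha0 : regular_left a b p0 q0 r) (ha1 : regular_left a b p1 q1 r)
  (hb0 : limit_point_right a b p0 q0 r) (hb1 : limit_point_right a b p1 q1 r)
  (u0 w0 : R -> R) (hu0 : minimal_solution a b p0 q0 r E u0 w0)
  (v0 : R -> R)
  (hv0 : forall x, oint a b x ->
     ((v0 x)%:E = (u0 x)%:E *
        \int[lebesgue_measure]_(t in oint a x%:E)
           ((p0 t * u0 t ^+ 2)^-1)%:E)%E) :
  let Dp := fun x => (p0 x)^-1 - (p1 x)^-1 in
  let Dq := fun x => q1 x - q0 x in
  let Q := fun x =>
    p0 x * v0 x ^+ 2 * (u0 x ^+ 2 * Dq x + w0 x ^+ 2 * Dp x) in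
  (p0 x * v0 x * w0 x * Dp x @[x --> left_end b] --> (0 : R)) ->
  (p0 x * Dp x @[x --> left_end b] --> (0 : R)) ->
  ((limf_esup (EFin \o Q) (left_end b) < (- (1 / 4))%:E)%E ->
     oscillatory a b p1 q1 r E) /\
  ((limf_einf (EFin \o Q) (left_end b) > (- (1 / 4))%:E)%E ->
     nonoscillatory a b p1 q1 r E).
Proof.
move=> Dp Dq Q e1_0 e2_0; split=> HQ.
- have [e e0 [c oc cQ]] := limf_esup_lt_near hab HQ.
  pose eta := Num.min e 1.
  have eta0 : 0 < eta by rewrite lt_min e0 ltr01.
  have eta6 : 0 < eta / 6 by lra.
  have [c1 oc1 H1] := cvg0_left_end_near hab eta6 e1_0.
  have [c2 oc2 H2] := cvg0_left_end_near hab eta6 e2_0.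
  apply: (oscillatory_of_decay hc0 hc1 ha1 hu0 hv0 eta0 _
    (oint_max (oint_max oc oc1) oc2)); first by rewrite ge_min lexx orbT.
  move=> t /oint_maxl[/oint_maxl[oct oc1t] oc2t]; split; [|exact: H1|exact: H2].
  apply: le_trans (cQ t oct) _; rewrite lerD2l lerN2.
  by rewrite ge_min lexx.
- have [e e0 [c oc cQ]] := limf_einf_gt_near hab HQ.
  have e4 : 0 < e / 4 by lra.
  have [c1 oc1 H1] := cvg0_left_end_near hab e4 e1_0.
  have [c2 oc2 H2] := cvg0_left_end_near hab e4 e2_0.
  apply: (nonoscillatory_of_subsolution hc0 hc1 ha1 hu0 hv0
    (oint_max (oint_max oc oc1) oc2)).
  move=> t /oint_maxl[/oint_maxl[oct oc1t] oc2t].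
  have := cQ t oct; have := H1 t oc1t; have := H2 t oc2t.
  rewrite !ler_norml /Q /Dp /Dq /= => /andP[h2 _] /andP[h1 _] hQ; lra.
Qed.
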